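(* Let $\Omega\subset\mathbb{C}$ be a domain and let $n\in\mathbb{N}$, $n\geq 2$, be such that $\#(\mathbb{C}\setminus\Omega)\geq 2n$. Suppose that the holomorphic automorphism group $\mathrm{Aut}(\Sigma^n(\Omega))$ of the $n$-th symmetrized product of $\Omega$ has the following property: for every $\Phi\in \mathrm{Aut}(\Sigma^n(\Omega))$ there exists a holomorphic map $\phi:\Omega\to\Omega$ such that $\Phi\equiv\Sigma^n\phi$. Then for every holomorphic automorphism $\Psi\in \mathrm{Aut}(S_n(\Omega))$ there exists a holomorphic automorphism $\psi$ of $\Omega$ such that \[ \sigma(\Psi(A))=\psi(\sigma(A))\quad\text{for all } A\in S_n(\Omega). \] In particular, $\mathrm{Aut}(S_n(\Omega))$ does not act transitively on $S_n(\Omega)$.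
   Context: $M_n(\mathbb{C})$ is the set of $n\times n$ complex matrices and $\sigma(A)$ denotes the set of eigenvalues of $A$. For a domain $\Omega\subseteq\mathbb{C}$ and $n\ge 2$, $S_n(\Omega):=\{A\in M_n(\mathbb{C}):\sigma(A)\subset\Omega\}$, which is a domain in $M_n(\mathbb{C})\cong\mathbb{C}^{n^2}$. The symmetrization map $\pi_n:\mathbb{C}^n\to\mathbb{C}^n$ is $\pi_n(z)=(\pi_{n,1}(z),\dots,\pi_{n,n}(z))$, where $\pi_{n,j}$ is the $j$-th elementary symmetric polynomial in $z_1,\dots,z_n$, i.e. $\prod_{j=1}^n(t-z_j)=t^n+\sum_{j=1}^n(-1)^j\pi_{n,j}(z)\,t^{n-j}$. The $n$-th symmetrized product of $\Omega$ is $\Sigma^n(\Omega):=\pi_n(\Omega^n)$, a domain in $\mathbb{C}^n$. For a holomorphic self-map $\phi:\Omega\to\Omega$, the induced holomorphic self-map $\Sigma^n\phi:\Sigma^n(\Omega)\to\Sigma^n(\Omega)$ is defined by $\Sigma^n\phi(\pi_n(z_1,\dots,z_n)):=\pi_n(\phi(z_1),\dots,\phi(z_n))$ for all $(z_1,\dots,z_n)\in\Omega^n$. $\mathrm{Aut}(D)$ denotes the group of holomorphic automorphisms (biholomorphic self-maps) of a domain $D$. *)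

(* Defs.v *)
From mathcomp Require Import all_boot all_order all_algebra.
From mathcomp Require Import complex.
From mathcomp Require mpoly.
From mathcomp Require Import all_classical all_reals all_analysis.

Set Implicit Arguments.
Unset Strict Implicit.
Unset Printing Implicit Defensive.

Import Order.TTheory GRing.Theory Num.Theory.
Import numFieldNormedType.Exports.

Local Open Scope classical_set_scope.
Local Open Scope ring_scope.

(* R[i] packed as a numClosedFieldType: the topology and the normed module
   structure that MathComp-Analysis puts on every numClosedFieldType are then
   found by unification, which does not happen for the bare type R[i]. *)
Definition Cplx (R : realType) : numClosedFieldType := R[i].

Section Holomorphy.
Context {R : realType}.
Local Notation C := (Cplx R).

Definition is_domain (V : normedModType C) (D : set V) : Prop :=
  [/\ D !=set0, open D & connected D].

(* [differentiable] is Frechet differentiability with a C-linear differential.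
   Maps are total functions; only their values on the open set D matter. *)
Definition holomorphic_on (V W : normedModType C) (D : set V) (f : V -> W) :
  Prop := forall x, D x -> differentiable f x.

Definition holomorphic_map (V W : normedModType C) (D : set V) (E : set W)
  (f : V -> W) : Prop := holomorphic_on D f /\ set_fun D E f.

(* f represents an element of Aut(D): total functions that agree on D
   represent the same automorphism. *)
Definition is_automorphism (V : normedModType C) (D : set V) (f : V -> V) :
  Prop :=
  holomorphic_map D D f /\
  exists g : V -> V, [/\ holomorphic_map D D g,
    (forall x, D x -> g (f x) = x) & (forall x, D x -> f (g x) = x)].

Definition acts_transitively (V : normedModType C) (D : set V) : Prop :=
  forall x y : V, D x -> D y ->
    exists f : V -> V, is_automorphism D f /\ f x = y.

End Holomorphy.

Section SymmetrizedProduct.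
Context {R : realType} (n : nat).
Local Notation C := (Cplx R).

Definition spectrum (A : 'M[C]_n) : set C := [set a | eigenvalue A a].

Definition spectral_set (Omega : set C) : set 'M[C]_n :=
  [set A | spectrum A `<=` Omega].

Definition cartesian_power (Omega : set C) : set 'rV[C]_n :=
  [set z | forall i, Omega (z 0 i)].

(* Column j holds the elementary symmetric polynomial of degree j + 1. *)
Definition symmetrization (z : 'rV[C]_n) : 'rV[C]_n :=
  \row_(j < n) mpoly.meval (fun i => z 0 i) (mpoly.mesym n C j.+1).

Definition symmetrized_product (Omega : set C) : set 'rV[C]_n :=
  symmetrization @` cartesian_power Omega.

(* The value at w is computed from a chosen preimage of w in Omega^n;
   [symmetrized_mapE] shows that it does not depend on the choice. *)
Definition symmetrized_map (Omega : set C) (phi : C -> C) (w : 'rV[C]_n) :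
  'rV[C]_n :=
  symmetrization (map_mx phi
    (xget 0 [set z | cartesian_power Omega z /\ symmetrization z = w])).

Lemma symmetrization_prod (z : 'rV[C]_n) :
  \prod_(j < n) ('X - (z 0 j)%:P) =
  'X^n + \sum_(j < n) ((-1) ^+ j.+1 * symmetrization z 0 j) *: 'X^(n - j.+1).
Proof.
pose cs := [tuple z 0 i | i < n].
have csE : \prod_(c <- cs) ('X - c%:P) = \prod_(j < n) ('X - (z 0 j)%:P).
  by rewrite big_map /= big_enum.
have tE : tnth cs = (fun i => z 0 i).
  by apply/funext => i; rewrite tnth_mktuple.
have mE (k : 'I_n.+1) := mpoly.mroots_coeff cs k.
rewrite tE csE in mE.
set P := \prod_(j < n) _ in mE *.
have sP : size P = n.+1 by rewrite /P size_prod_XsubC /index_enum -enumT size_enum_ord.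
have mP : P`_n = 1.
  have /monicP := monic_prod_XsubC (index_enum 'I_n) xpredT (fun i => z 0 i).
  by rewrite lead_coefE -/P sP.
rewrite -[LHS]coefK poly_def sP big_ord_recr /= mP scale1r addrC; congr (_ + _).
rewrite (reindex_inj rev_ord_inj) /=; apply: eq_bigr => j _.
by rewrite (mE (lift ord0 j)) mxE.
Qed.

Lemma symmetrization_map (phi : C -> C) (z z' : 'rV[C]_n) :
  symmetrization z = symmetrization z' ->
  symmetrization (map_mx phi z) = symmetrization (map_mx phi z').
Proof.
move=> e.
have e1 : \prod_(j < n) ('X - (z 0 j)%:P) = \prod_(j < n) ('X - (z' 0 j)%:P).
  by rewrite !symmetrization_prod e.
pose s (y : 'rV[C]_n) := [seq y 0 j | j <- enum 'I_n].
have sE (y : 'rV[C]_n) : \prod_(c <- s y) ('X - c%:P) =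
    \prod_(j < n) ('X - (y 0 j)%:P).
  by rewrite big_map big_enum.
have pzz' : perm_eq (s z) (s z').
  by apply: prod_XsubC_eq; rewrite !sE.
have sM (y : 'rV[C]_n) : s (map_mx phi y) = map phi (s y).
  by rewrite -map_comp; apply: eq_map => j /=; rewrite mxE.
have e2 : \prod_(j < n) ('X - (map_mx phi z 0 j)%:P) =
    \prod_(j < n) ('X - (map_mx phi z' 0 j)%:P).
  by rewrite -!sE; apply: perm_big; rewrite !sM; apply: perm_map.
apply/rowP => j.
have tE (y : 'rV[C]_n) : tnth [tuple y 0 i | i < n] = (fun i => y 0 i).
  by apply/funext => i; rewrite tnth_mktuple.
have mE (y : 'rV[C]_n) :=
  mpoly.mroots_coeff [tuple y 0 i | i < n] (lift ord0 j).
have := mE (map_mx phi z); have := mE (map_mx phi z').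
rewrite !tE /= -/(s _) -/(s _) !sE e2 => -> /eqP.
rewrite (inj_eq (mulfI _)) ?signr_eq0 // => /eqP.
by rewrite !mxE => ->.
Qed.

Lemma symmetrized_mapE (Omega : set C) (phi : C -> C) (z : 'rV[C]_n) :
  cartesian_power Omega z ->
  symmetrized_map Omega phi (symmetrization z) =
  symmetrization (map_mx phi z).
Proof.
move=> Oz; apply: symmetrization_map.
by have [] := xgetPex 0 (ex_intro (fun y => cartesian_power Omega y /\
  symmetrization y = symmetrization z) z (conj Oz erefl)).
Qed.

End SymmetrizedProduct.

Arguments spectral_set {R} n Omega.
Arguments symmetrized_product {R} n Omega.

(* Main.v *)
Require Import Defs.
From mathcomp Require Import all_boot all_order all_algebra.
From mathcomp Require Import perm complex.
From mathcomp Require Import all_classical all_reals all_analysis.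
From mathcomp Require Import zify ring lra.

Set Implicit Arguments.
Unset Strict Implicit.
Unset Printing Implicit Defensive.

Import Order.TTheory GRing.Theory Num.Theory.
Import numFieldNormedType.Exports.

Local Open Scope classical_set_scope.
Local Open Scope ring_scope.

(** The automorphism Psi permutes the fibres of the characteristic polynomial;
this is what has to be shown, the rest being bookkeeping.

Write S for the set of matrices with spectrum in Omega, and suppose that Psi
maps S holomorphically into S.  Two matrices of S with the same characteristic
polynomial are joined, inside their fibre, by a chain of entire curves: an
invertible matrix P lies on an entire curve of invertible matrices through the
identity (triangularise P, take logarithms of the diagonal entries), hence A and
P A P^-1 are joined by a curve of conjugates, and a triangular matrix is joined
to its diagonal part by an affine line ([fibre_same_image]).  Along an entire
curve gamma in a fibre, let p_z be the characteristic polynomial of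
Psi (gamma z).  For each of the 2n points a_k outside Omega the function
z |-> p_z (a_k) is entire without zeros.  Such a family of monic polynomials of
degree n is constant ([monic_family_constant]): if at least n + 1 of these
functions were not constant, then Lagrange interpolation would give a relation
sum_j c_j u_j = 1 between them, and Borel's theorem ([borel]) says that such a
relation between entire functions without zeros makes one of them constant; so
at least n of the values p_z (a_k) do not depend on z, and they determine p_z.

Consequently Psi covers a holomorphic self-map of the symmetrized product, with
the companion matrix as holomorphic section ([pushdown]); for an automorphism
Psi it is an automorphism, hence of the form Sigma^n phi, and the same argument
for the inverse of Psi shows that phi is an automorphism of Omega.  Comparing
roots of characteristic polynomials gives sigma (Psi A) = phi (sigma A).  An
automorphism therefore cannot send a scalar matrix to a matrix with two
distinct eigenvalues, so the action is not transitive.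

Borel's theorem is proved from the mere existence of the complex derivative.
The only integral theorem used is the estimate |f 0| <= sup |f| over a circle
around 0 ([mean_value_bound]); in the coordinate log z it is Goursat's theorem
on a rectangle, carried out with dyadic midpoint sums in place of integrals.  It
gives Cauchy estimates, Taylor coefficients and logarithms of entire functions
without zeros.  Given a relation sum_j c_j u_j = 1 of minimal length, with
u_j = u_j(0) exp h_j, some determinant D of the quotients u_j^(i_k) / u_j does
not vanish at 0, and Cramer's rule bounds D and all the D u_j on the circle of
radius r in terms of these quotients.  The maximum principle for D^2 exp E, with E an
entire function chosen so that Re E = (1 + c) Re h_j on the circle and c is the
cosine that picks out the n-th Taylor coefficient, bounds the largest Taylor
term mu r of the h_j by the logarithm of the bound on the quotients, that is,
by O(log (mu s)) for s slightly larger than r ([indep_units]).  Such a growth is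
impossible unless all the h_j vanish ([borel_growth]). *)

(** * Complex numbers with a real-valued modulus *)

Section Modulus.
Context {R : realType}.
Local Notation C := (Cplx R).
Implicit Types (x y : R) (z w : C).

Definition re z : R := complex.Re (z : R[i]).
Definition im z : R := complex.Im (z : R[i]).
Definition mkc x y : C := Complex x y.
Definition rc x : C := mkc x 0.
Definition cj z : C := mkc (re z) (- im z).
(** Estimates need a modulus with values in the ordered field R, whereas the norm
of Cplx R takes its values in Cplx R. *)
Definition cabs z : R := Num.sqrt (re z ^+ 2 + im z ^+ 2).

Lemma reim_ext z w : re z = re w -> im z = im w -> z = w.
Proof. by case: z => a b; case: w => c d /= -> ->. Qed.

Lemma reD z w : re (z + w) = re z + re w.
Proof. by case: z => a b; case: w. Qed.
Lemma imD z w : im (z + w) = im z + im w.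
Proof. by case: z => a b; case: w. Qed.
Lemma reN z : re (- z) = - re z. Proof. by case: z. Qed.
Lemma imN z : im (- z) = - im z. Proof. by case: z. Qed.
Lemma reB z w : re (z - w) = re z - re w. Proof. by rewrite reD reN. Qed.
Lemma imB z w : im (z - w) = im z - im w. Proof. by rewrite imD imN. Qed.
Lemma reM z w : re (z * w) = re z * re w - im z * im w.
Proof. by case: z => a b; case: w. Qed.
Lemma imM z w : im (z * w) = re z * im w + im z * re w.
Proof. by case: z => a b; case: w. Qed.
Lemma re0 : re 0 = 0. Proof. by []. Qed.
Lemma im0 : im 0 = 0. Proof. by []. Qed.
Lemma re1 : re 1 = 1. Proof. by []. Qed.
Lemma im1 : im 1 = 0. Proof. by []. Qed.
Lemma re_mkc x y : re (mkc x y) = x. Proof. by []. Qed.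
Lemma im_mkc x y : im (mkc x y) = y. Proof. by []. Qed.
Lemma re_rc x : re (rc x) = x. Proof. by []. Qed.
Lemma im_rc x : im (rc x) = 0. Proof. by []. Qed.
Lemma re_cj z : re (cj z) = re z. Proof. by []. Qed.
Lemma im_cj z : im (cj z) = - im z. Proof. by []. Qed.

Definition reimE := (reD, imD, reN, imN, reM, imM, re0, im0, re1, im1,
  re_mkc, im_mkc, re_rc, im_rc, re_cj, im_cj).

Lemma rcD x y : rc (x + y) = rc x + rc y. Proof. by apply: reim_ext; rewrite !reimE ?addr0. Qed.
Lemma rcN x : rc (- x) = - rc x. Proof. by apply: reim_ext; rewrite !reimE ?oppr0. Qed.
Lemma rcB x y : rc (x - y) = rc x - rc y. Proof. by rewrite rcD rcN. Qed.
Lemma rcM x y : rc (x * y) = rc x * rc y.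
Proof. by apply: reim_ext; rewrite !reimE; ring. Qed.
Lemma rc0 : rc 0 = 0. Proof. by []. Qed.
Lemma rc1 : rc 1 = 1. Proof. by []. Qed.
Lemma rc_nat n : rc n%:R = n%:R.
Proof. by elim: n => // n IH; rewrite -!natr1 rcD IH. Qed.
Lemma rc_inj : injective rc. Proof. by move=> x y []. Qed.
Lemma rc_eq0 x : (rc x == 0) = (x == 0).
Proof. by rewrite -rc0 (inj_eq rc_inj). Qed.
Lemma rcV x : rc x^-1 = (rc x)^-1.
Proof.
have [->|x0] := eqVneq x 0; first by rewrite invr0 rc0 invr0.
by apply: (mulfI (x := rc x)); rewrite ?rc_eq0// -rcM !divff ?rc_eq0.
Qed.
Lemma rcX x n : rc (x ^+ n) = rc x ^+ n.
Proof. by elim: n => [|n IH]; rewrite ?expr0 ?rc1// !exprS rcM IH. Qed.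

Lemma cjD z w : cj (z + w) = cj z + cj w.
Proof. by apply: reim_ext; rewrite !reimE ?opprD. Qed.
Lemma cjM z w : cj (z * w) = cj z * cj w.
Proof. by apply: reim_ext; rewrite !reimE; ring. Qed.
Lemma cj0 : cj 0 = 0. Proof. by apply: reim_ext; rewrite !reimE ?oppr0. Qed.
Lemma cj1 : cj 1 = 1. Proof. by apply: reim_ext; rewrite !reimE ?oppr0. Qed.
Lemma cjX z n : cj (z ^+ n) = cj z ^+ n.
Proof. by elim: n => [|n IH]; rewrite ?expr0 ?cj1// !exprS cjM IH. Qed.
Lemma cj_sum I (r : seq I) (P : pred I) (F : I -> C) :
  cj (\sum_(i <- r | P i) F i) = \sum_(i <- r | P i) cj (F i).
Proof. by elim/big_rec2: _ => [|i x y _ <-]; rewrite ?cj0 ?cjD. Qed.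

Lemma cabs_ge0 z : 0 <= cabs z. Proof. exact: sqrtr_ge0. Qed.
Lemma cabs_sqr z : cabs z ^+ 2 = re z ^+ 2 + im z ^+ 2.
Proof. by rewrite sqr_sqrtr// addr_ge0 ?sqr_ge0. Qed.
Lemma mulcj z : z * cj z = rc (cabs z ^+ 2).
Proof. by rewrite cabs_sqr; apply: reim_ext; rewrite !reimE; ring. Qed.
Lemma cabsM z w : cabs (z * w) = cabs z * cabs w.
Proof.
rewrite /cabs -sqrtrM ?addr_ge0 ?sqr_ge0//; congr Num.sqrt.
by rewrite !reimE; ring.
Qed.
Lemma cabsN z : cabs (- z) = cabs z.
Proof. by rewrite /cabs !reimE !sqrrN. Qed.
Lemma cabs_rc x : cabs (rc x) = `|x|.
Proof. by rewrite /cabs !reimE expr0n addr0 sqrtr_sqr. Qed.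
Lemma cabs0 : cabs 0 = 0. Proof. by rewrite -rc0 cabs_rc normr0. Qed.
Lemma cabs1 : cabs 1 = 1. Proof. by rewrite -rc1 cabs_rc normr1. Qed.
Lemma cabs_eq0 z : (cabs z == 0) = (z == 0).
Proof.
apply/eqP/eqP => [z0|->]; last exact: cabs0.
have := cabs_sqr z; rewrite z0 expr0n /= => /esym/eqP.
rewrite paddr_eq0 ?sqr_ge0// !sqrf_eq0 => /andP[/eqP a0 /eqP b0].
by apply: reim_ext.
Qed.
Lemma cabs_gt0 z : (0 < cabs z) = (z != 0).
Proof. by rewrite lt_def cabs_eq0 cabs_ge0 andbT. Qed.
Lemma cabsX z n : cabs (z ^+ n) = cabs z ^+ n.
Proof. by elim: n => [|n IH]; rewrite ?expr0 ?cabs1// !exprS cabsM IH. Qed.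
Lemma cabsV z : cabs z^-1 = (cabs z)^-1.
Proof.
have [->|z0] := eqVneq z 0; first by rewrite invr0 cabs0 invr0.
by apply: (mulfI (x := cabs z)); rewrite ?cabs_eq0// -cabsM !divff ?cabs_eq0// cabs1.
Qed.
Lemma re_le z : `|re z| <= cabs z.
Proof. by rewrite -sqrtr_sqr ler_wsqrtr// lerDl sqr_ge0. Qed.
Lemma im_le z : `|im z| <= cabs z.
Proof. by rewrite -sqrtr_sqr ler_wsqrtr// lerDr sqr_ge0. Qed.
Lemma cabs_le z : cabs z <= `|re z| + `|im z|.
Proof.
rewrite -(@ler_pXn2r _ 2%N) ?nnegrE ?addr_ge0 ?cabs_ge0//.
rewrite cabs_sqr sqrrD !real_normK ?num_real//.
have := mulr_ge0 (normr_ge0 (re z)) (normr_ge0 (im z)); lra.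
Qed.
Lemma cabsD z w : cabs (z + w) <= cabs z + cabs w.
Proof.
rewrite -(@ler_pXn2r _ 2%N) ?nnegrE ?addr_ge0 ?cabs_ge0//.
rewrite sqrrD !cabs_sqr !reimE -cabsM.
have h : re z * re w + im z * im w <= cabs z * cabs w.
  have := re_le (z * cj w); rewrite !reimE mulrN opprK cabsM.
  rewrite (_ : cabs (cj w) = cabs w); last by rewrite /cabs !reimE sqrrN.
  exact/le_trans/ler_norm.
rewrite cabsM; lra.
Qed.
Lemma cabsB z w : cabs (z - w) <= cabs z + cabs w.
Proof. by rewrite -(cabsN w) cabsD. Qed.
Lemma cabsC z w : cabs (z - w) = cabs (w - z).
Proof. by rewrite -cabsN opprB. Qed.
Lemma cabs_tri u z w : cabs (z - w) <= cabs (z - u) + cabs (u - w).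
Proof. by rewrite -{1}(subrK u z) -addrA cabsD. Qed.
Lemma cabs_sub z w : cabs z - cabs w <= cabs (z - w).
Proof. by have := cabsD (z - w) w; rewrite subrK; lra. Qed.
Lemma cabs_cj z : cabs (cj z) = cabs z.
Proof. by rewrite /cabs !reimE sqrrN. Qed.
Lemma cabs_sum I (r : seq I) (P : pred I) (F : I -> C) :
  cabs (\sum_(i <- r | P i) F i) <= \sum_(i <- r | P i) cabs (F i).
Proof.
elim/big_rec2: _ => [|i x y _ h]; first by rewrite cabs0.
by apply: le_trans (cabsD _ _) _; rewrite lerD2l.
Qed.
Lemma cabs_prod I (r : seq I) (P : pred I) (F : I -> C) :
  cabs (\prod_(i <- r | P i) F i) = \prod_(i <- r | P i) cabs (F i).
Proof. by elim/big_rec2: _ => [|i x y _ <-]; rewrite ?cabs1 ?cabsM. Qed.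

Lemma normC_cabs z : `|z| = rc (cabs z) :> C.
Proof. exact: (normc_def (z : R[i])). Qed.
Lemma ltC_rc x y : (rc x < rc y :> C) = (x < y).
Proof. exact: (ltcR x y). Qed.
Lemma leC_rc x y : (rc x <= rc y :> C) = (x <= y).
Proof. exact: (lecR x y). Qed.
Lemma cabs_nat n : cabs n%:R = n%:R.
Proof. by rewrite -rc_nat cabs_rc normr_nat. Qed.

End Modulus.

(** * Complex derivatives and entire functions *)

Section ComplexDerivative.
Context {R : realType}.
Local Notation C := (Cplx R).
Implicit Types (f g : C -> C) (z d : C).

Lemma gt0C_rc (e : C) : 0 < e -> e = rc (re e) /\ 0 < re e.
Proof.
move=> e0; have e1 := ger0_norm (ltW e0); rewrite normC_cabs in e1.
have e2 : re e = cabs e by rewrite -{1}e1.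
by rewrite e2 e1; split=> //; rewrite -e2 -ltC_rc e2 e1.
Qed.

(** The derivative in terms of real epsilon and delta, the form in which all the
estimates below use it. *)
Lemma cderivP f z d : is_derive z 1 f d <->
  forall e : R, 0 < e -> exists2 dl : R, 0 < dl &
    forall s, cabs s < dl -> cabs (f (z + s) - f z - d * s) <= e * cabs s.
Proof.
pose q := fun h : C => h^-1 *: (f (h *: 1 + z) - f z).
have qE (s : C) : s != 0 -> cabs (f (z + s) - f z - d * s) = cabs (d - q s) * cabs s.
  move=> s0; rewrite -cabsM mulrBl /q [_ *: (1 : C)]mulr1 [_ *: _]mulrC mulrVK ?unitfE//.
  by rewrite (addrC s) cabsC.
have key : (q h @[h --> 0^'] --> d) <->
  forall e : R, 0 < e -> exists2 dl : R, 0 < dl &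
    forall s, cabs s < dl -> cabs (f (z + s) - f z - d * s) <= e * cabs s.
  split.
    move=> /cvgrPdist_le h e e0.
    have [|dl dl0 hdl] := h (rc e); first by rewrite -rc0 ltC_rc.
    have [dlE dl0'] := gt0C_rc dl0.
    exists (re dl) => // s sdl.
    have [->|s0] := eqVneq s 0; first by rewrite addr0 subrr mulr0 subr0 cabs0 mulr0.
    rewrite qE// ler_wpM2r ?cabs_ge0//.
    have := hdl s; rewrite /= sub0r normrN normC_cabs dlE ltC_rc => /(_ sdl s0).
    by rewrite normC_cabs leC_rc.
  move=> h; apply/cvgrPdist_le => e /gt0C_rc[-> e0].
  have [dl dl0 hdl] := h _ e0.
  exists (rc dl); first by rewrite /= -rc0 ltC_rc.
  move=> s /=; rewrite sub0r normrN normC_cabs ltC_rc => sdl s0.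
  have := hdl s sdl; rewrite qE// ler_pM2r ?cabs_gt0//.
  by rewrite normC_cabs leC_rc.
split.
  by move=> [df dE]; apply/key; rewrite -dE; exact: df.
move/key => h; split; first by apply/cvg_ex; exists d.
exact: cvg_lim h.
Qed.

Definition entire f := forall z, derivable f z 1.
Definition cder f z : C := 'D_1 f z.

Lemma cder_ex f z : derivable f z 1 -> is_derive z 1 f (cder f z).
Proof. exact: derivableP. Qed.
Lemma cder_val f z d : is_derive z 1 f d -> cder f z = d.
Proof. by move=> h; rewrite /cder derive_val. Qed.
Lemma is_derive_derivable f z d : is_derive z 1 f d -> derivable f z 1.
Proof. by case. Qed.

Lemma cder_cont f z : derivable f z 1 -> forall e : R, 0 < e ->
  exists2 dl : R, 0 < dl & forall s, cabs s < dl -> cabs (f (z + s) - f z) <= e.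
Proof.
move=> /cder_ex; set d := cder f z => /cderivP/(_ 1 ltr01)[dl dl0 h] e e0.
have k0 : 0 < 1 + cabs d by have := cabs_ge0 d; lra.
exists (Num.min dl (e / (1 + cabs d))); first by rewrite lt_min dl0 divr_gt0.
move=> s; rewrite lt_min ltr_pdivlMr// => /andP[/h s1 s2].
have : cabs (f (z + s) - f z) <= cabs (f (z + s) - f z - d * s) + cabs (d * s).
  by rewrite -{1}(subrK (d * s) (f (z + s) - f z)) cabsD.
rewrite cabsM; move: s1 s2; lra.
Qed.

Lemma cderiv_cst (a : C) z : is_derive z 1 (fun=> a) 0.
Proof. exact: is_derive_cst. Qed.
Lemma cderiv_id z : is_derive z 1 (fun x : C => x) 1.
Proof. exact: is_derive_id. Qed.
Lemma cderivD f g z d d' : is_derive z 1 f d -> is_derive z 1 g d' ->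
  is_derive z 1 (fun x => f x + g x) (d + d').
Proof. by move=> hf hg; exact: is_deriveD. Qed.
Lemma cderivN f z d : is_derive z 1 f d -> is_derive z 1 (fun x => - f x) (- d).
Proof. by move=> hf; exact: is_deriveN. Qed.
Lemma cderivB f g z d d' : is_derive z 1 f d -> is_derive z 1 g d' ->
  is_derive z 1 (fun x => f x - g x) (d - d').
Proof. by move=> hf hg; exact: is_deriveB. Qed.
Lemma cderivM f g z d d' : is_derive z 1 f d -> is_derive z 1 g d' ->
  is_derive z 1 (fun x => f x * g x) (d * g z + f z * d').
Proof.
move=> hf hg; have h := is_deriveM hf hg.
by rewrite addrC [d * g z]mulrC; exact: h.
Qed.
Lemma cderivV f z d : f z != 0 -> is_derive z 1 f d ->
  is_derive z 1 (fun x => (f x)^-1) (- d / f z ^+ 2).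
Proof.
move=> f0 hf; have df := is_derive_derivable hf.
split; first exact: derivableV.
rewrite deriveV// derive_val -[LHS]/(- (f z) ^- 2 * d).
by rewrite !mulNr mulrC.
Qed.

Lemma cderiv_comp f g z d d' : is_derive z 1 g d' -> is_derive (g z) 1 f d ->
  is_derive z 1 (fun x => f (g x)) (d * d').
Proof.
move=> hg hf; apply/cderivP => e e0.
have k0 : 0 < 1 + cabs d + cabs d' by have := cabs_ge0 d; have := cabs_ge0 d'; lra.
pose e1 := Num.min 1 (e / (1 + cabs d + cabs d')).
have e10 : 0 < e1 by rewrite lt_min ltr01 divr_gt0.
have e11 : e1 <= 1 by rewrite ge_min lexx.
have e1e : e1 * (1 + cabs d + cabs d') <= e by rewrite -ler_pdivlMr// ge_min lexx orbT.
have [d1 d10 h1] := (cderivP _ _ _).1 hf _ e10.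
have [d2 d20 h2] := (cderivP _ _ _).1 hg _ e10.
have [d3 d30 h3] := cder_cont (is_derive_derivable hg) (divr_gt0 d10 (ltr0n _ 2)).
exists (Num.min d2 d3); first by rewrite lt_min d20.
move=> s; rewrite lt_min => /andP[sd2 sd3].
have {}h3 := h3 _ sd3.
have {}h2 := h2 _ sd2.
set t := g (z + s) - g z in h2 h3.
have : cabs t < d1 by lra.
move=> /h1 {h1}; rewrite (_ : g z + t = g (z + s)); last by rewrite /t addrC subrK.
move=> h1.
have -> : f (g (z + s)) - f (g z) - d * d' * s =
  (f (g (z + s)) - f (g z) - d * t) + d * (t - d' * s) by ring.
apply: le_trans (cabsD _ _) _; rewrite cabsM.
have tb : cabs t <= (e1 + cabs d') * cabs s.
  have := cabsD (t - d' * s) (d' * s); rewrite subrK cabsM.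
  by move: h2; lra.
have s0 := cabs_ge0 s; have dd := cabs_ge0 d; have dd' := cabs_ge0 d'.
apply: (@le_trans _ _ (e1 * ((e1 + cabs d') * cabs s) + cabs d * (e1 * cabs s))).
  by apply: lerD; [apply: le_trans h1 _; rewrite ler_pM2l|rewrite ler_wpM2l].
apply: (@le_trans _ _ (e1 * (1 + cabs d + cabs d') * cabs s)); last by rewrite ler_wpM2r.
rewrite -subr_ge0.
rewrite (_ : _ - _ = e1 * cabs s * (1 - e1)); last by ring.
by rewrite !mulr_ge0 ?subr_ge0// ltW.
Qed.

Lemma cderiv_ext f g z d : (forall x, f x = g x) -> is_derive z 1 f d -> is_derive z 1 g d.
Proof. by move=> /funext ->. Qed.

Lemma entire_cst (a : C) : entire (fun=> a).
Proof. by move=> z; apply: is_derive_derivable (cderiv_cst a z). Qed.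
Lemma entire_id : entire (fun x => x).
Proof. by move=> z; apply: is_derive_derivable (cderiv_id z). Qed.
Lemma entireD f g : entire f -> entire g -> entire (fun x => f x + g x).
Proof. by move=> hf hg z; exact: is_derive_derivable (cderivD (cder_ex (hf z)) (cder_ex (hg z))). Qed.
Lemma entireB f g : entire f -> entire g -> entire (fun x => f x - g x).
Proof. by move=> hf hg z; exact: is_derive_derivable (cderivB (cder_ex (hf z)) (cder_ex (hg z))). Qed.
Lemma entireM f g : entire f -> entire g -> entire (fun x => f x * g x).
Proof. by move=> hf hg z; exact: is_derive_derivable (cderivM (cder_ex (hf z)) (cder_ex (hg z))). Qed.
Lemma entireV f : (forall z, f z != 0) -> entire f -> entire (fun x => (f x)^-1).
Proof. by move=> f0 hf z; exact: is_derive_derivable (cderivV (f0 z) (cder_ex (hf z))). Qed.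
Lemma entire_comp f g : entire f -> entire g -> entire (fun x => f (g x)).
Proof. by move=> hf hg z; exact: is_derive_derivable (cderiv_comp (cder_ex (hg z)) (cder_ex (hf (g z)))). Qed.
Lemma entireX f n : entire f -> entire (fun x => f x ^+ n).
Proof.
move=> hf; elim: n => [|n IH]; first exact: entire_cst.
by rewrite (_ : (fun x => f x ^+ n.+1) = (fun x => f x * f x ^+ n)); [exact: entireM|apply/funext => x; rewrite exprS].
Qed.
Lemma entire_sum I (r : seq I) (P : pred I) (F : I -> C -> C) :
  (forall i, entire (F i)) -> entire (fun x => \sum_(i <- r | P i) F i x).
Proof.
move=> hF; elim: r => [|i r IH].
  by rewrite (_ : (fun x => _) = fun=> 0); [exact: entire_cst|apply/funext => x; rewrite big_nil].
rewrite (_ : (fun x => _) = fun x => if P i then F i x + \sum_(i <- r | P i) F i x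
   else \sum_(i <- r | P i) F i x); last by apply/funext => x; rewrite big_cons.
case: (P i); last exact: IH.
by apply: entireD; [exact: hF|exact: IH].
Qed.
Lemma entire_prod I (r : seq I) (P : pred I) (F : I -> C -> C) :
  (forall i, entire (F i)) -> entire (fun x => \prod_(i <- r | P i) F i x).
Proof.
move=> hF; elim: r => [|i r IH].
  by rewrite (_ : (fun x => _) = fun=> 1); [exact: entire_cst|apply/funext => x; rewrite big_nil].
rewrite (_ : (fun x => _) = fun x => if P i then F i x * \prod_(i <- r | P i) F i x
   else \prod_(i <- r | P i) F i x); last by apply/funext => x; rewrite big_cons.
case: (P i); last exact: IH.
by apply: entireM; [exact: hF|exact: IH].
Qed.
Lemma entire_det n (F : C -> 'M[C]_n) : (forall i j, entire (fun x => F x i j)) ->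
  entire (fun x => \det (F x)).
Proof.
move=> hF; apply: (@entire_sum _ (index_enum _) xpredT
  (fun (s : {perm 'I_n}) x => (-1) ^+ s * \prod_i F x i (s i))) => s.
apply: entireM; first exact: entire_cst.
by apply: entire_prod => i; exact: hF.
Qed.

End ComplexDerivative.

(** * The complex exponential *)

Section ComplexExponential.
Context {R : realType}.
Local Notation C := (Cplx R).

Definition cexp (z : C) : C :=
  mkc (expR (re z) * cos (im z)) (expR (re z) * sin (im z)).

Lemma cexp0 : cexp 0 = 1.
Proof. by apply: reim_ext; rewrite /cexp !reimE expR0 ?cos0 ?sin0 ?mulr0 ?mulr1. Qed.
Lemma cexpD z w : cexp (z + w) = cexp z * cexp w.
Proof. by apply: reim_ext; rewrite /cexp !reimE expRD ?cosD ?sinD; ring. Qed.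
Lemma cabs_cexp z : cabs (cexp z) = expR (re z).
Proof.
rewrite /cabs /cexp !reimE (_ : _ + _ = expR (re z) ^+ 2 * (cos (im z) ^+ 2 + sin (im z) ^+ 2)); last by ring.
by rewrite cos2Dsin2 mulr1 sqrtr_sqr ger0_norm// expR_ge0.
Qed.
Lemma cexp_neq0 z : cexp z != 0.
Proof. by rewrite -cabs_gt0 cabs_cexp expR_gt0. Qed.
Lemma cexp_2pi t : cexp (mkc t (pi *+ 2)) = cexp (rc t).
Proof. by apply: reim_ext; rewrite /cexp !reimE ?cos2pi ?sin2pi ?cos0 ?sin0. Qed.

Lemma real_deriv_eps (f : R -> R) (x d : R) : is_derive x 1 f d -> forall e : R, 0 < e ->
  exists2 dl : R, 0 < dl & forall s, `|s| < dl -> `|f (x + s) - f x - d * s| <= e * `|s|.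
Proof.
move=> [df dE] e e0.
have : (fun h : R => h^-1 *: (f (h *: 1 + x) - f x)) @ 0^' --> d by rewrite -dE; exact: df.
move=> /cvgrPdist_le/(_ e e0)[dl /= dl0 h].
exists dl => // s sdl.
have [->|s0] := eqVneq s 0; first by rewrite addr0 subrr mulr0 subr0 normr0 mulr0.
have := h s; rewrite /= sub0r normrN => /(_ sdl s0).
rewrite [_ *: (1 : R)]mulr1 => h1.
have -> : f (x + s) - f x - d * s = - ((d - s^-1 * (f (s + x) - f x)) * s).
  by rewrite (addrC s); field.
by rewrite normrN normrM ler_wpM2r.
Qed.

Lemma cderiv_cexp0 : is_derive (0 : C) 1 cexp 1.
Proof.
apply/cderivP => e e0.
have [d1 d10 h1] := real_deriv_eps (is_derive_expR 0) (divr_gt0 e0 (ltr0n _ 20)).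
have [d2 d20 h2] := real_deriv_eps (is_derive_cos 0) (divr_gt0 e0 (ltr0n _ 20)).
have [d3 d30 h3] := real_deriv_eps (is_derive_sin 0) (divr_gt0 e0 (ltr0n _ 20)).
pose d4 : R := Num.min 2^-1 (e / 20).

exists (Num.min (Num.min d1 d2) (Num.min d3 d4)); first by rewrite !lt_min d10 d20 d30 ?invr_gt0 ?ltr0n ?divr_gt0.
move=> s; rewrite add0r !lt_min => /andP[/andP[s1 s2] /andP[s3 /andP[s4 s5]]].
have rs := re_le s; have is_ := im_le s.
have {h1} := h1 (re s) (le_lt_trans rs s1).
have {h2} := h2 (im s) (le_lt_trans is_ s2).
have {h3} := h3 (im s) (le_lt_trans is_ s3).
rewrite !add0r expR0 cos0 sin0 oppr0 mul0r !subr0 addr0 !mul1r.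
set a := re s in rs *; set b := im s in is_ *; set n := cabs s in rs is_ s1 s2 s3 s4 s5 *.
set X := expR a; set Y := cos b; set Z := sin b => h3 h2 h1.
have a0 := normr_ge0 a; have b0 := normr_ge0 b.
have e20p : 0 <= e / 20 by rewrite ltW// divr_gt0.
have ea : e / 20 * `|a| <= e / 20 * n by rewrite ler_wpM2l.
have eb : e / 20 * `|b| <= e / 20 * n by rewrite ler_wpM2l.
have X0 : 0 <= X by exact: expR_ge0.
have e20 : e / 20 * n <= e / 20 * 1 by rewrite ler_wpM2l//; lra.
have Xn : X <= 3.
  have := @expR_ge1Dx R (- a); rewrite expRN -/X => hX.
  have := ler_norm a => la.
  have X1 : 0 < X by exact: expR_gt0.
  have : X * (1 - a) <= X * X^-1 by rewrite ler_wpM2l.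
  rewrite divff ?gt_eqF// => hXa.
  have : X * 2^-1 <= X * (1 - a) by rewrite ler_wpM2l//; lra.
  by lra.
have Xa : `|X - 1| <= e / 20 * n + `|a|.
  have -> : X - 1 = (X - 1 - a) + a by rewrite subrK.
  by apply: le_trans (ler_normD _ _) _; rewrite lerD2r; lra.
apply: le_trans (cabs_le _) _.
rewrite cexp0 /cexp !reimE -/a -/b -/X -/Y -/Z.
have -> : X * Y - 1 - a = X * (Y - 1) + (X - 1 - a) by ring.
have -> : X * Z - 0 - b = X * (Z - b) + (X - 1) * b by ring.
have n0 : 0 <= n by exact: cabs_ge0.
have t1 : `|X * (Y - 1)| <= 3 * (e / 20 * n).
  by rewrite normrM (ger0_norm X0) ler_pM//; lra.
have t2 : `|X * (Z - b)| <= 3 * (e / 20 * n).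
  by rewrite normrM (ger0_norm X0) ler_pM//; lra.
have t3 : `|(X - 1) * b| <= (e / 20 + e / 20) * n.
  by rewrite normrM ler_pM//; lra.
have en : 0 <= e * n by rewrite mulr_ge0// ltW.
have := ler_normD (X * (Y - 1)) (X - 1 - a).
have := ler_normD (X * (Z - b)) ((X - 1) * b).
lra.
Qed.

Lemma cderiv_cexp (z : C) : is_derive z 1 cexp (cexp z).
Proof.
have h1 : is_derive z 1 (fun x : C => x - z) (1 - 0) := cderivB (cderiv_id z) (cderiv_cst z z).
have h0 : is_derive (z - z) 1 cexp 1 by rewrite subrr; exact: cderiv_cexp0.
have h := cderivM (cderiv_cst (cexp z) z) (cderiv_comp h1 h0).
move: h; rewrite mul0r add0r subr0 !mulr1; apply: cderiv_ext => x.
by rewrite -cexpD addrC subrK.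
Qed.

Lemma entire_cexp : entire (cexp : C -> C).
Proof. by move=> z; exact: is_derive_derivable (cderiv_cexp z). Qed.

(** The polar form of c. *)
Lemma cexp_surj (c : C) : c != 0 -> exists t, cexp t = c.
Proof.
move=> c0; have n0 : 0 < cabs c by rewrite cabs_gt0.
have nn := cabs_sqr c; have n2 : cabs c ^+ 2 != 0 by rewrite expf_neq0// gt_eqF.
have xb : -1 <= re c / cabs c <= 1.
  by rewrite -ler_norml normrM normfV (ger0_norm (ltW n0)) ler_pdivrMr// mul1r re_le.
have hs : sin (acos (re c / cabs c)) = `|im c| / cabs c.
  rewrite sin_acos//.
  have -> : 1 - (re c / cabs c) ^+ 2 = (im c / cabs c) ^+ 2.
    rewrite !expr_div_n -[1](divff n2) -mulrBl; congr (_ / _).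
    by rewrite nn addrC addKr.
  by rewrite sqrtr_sqr normrM normfV (ger0_norm (ltW n0)).
have hc := acosK xb.
have [i0|i0] := leP 0 (im c).
  exists (mkc (ln (cabs c)) (acos (re c / cabs c))).
  rewrite ger0_norm// in hs.
  by apply: reim_ext; rewrite /cexp !reimE lnK ?posrE// ?hc ?hs mulrC mulfVK ?gt_eqF.
exists (mkc (ln (cabs c)) (- acos (re c / cabs c))).
rewrite ltr0_norm// in hs.
by apply: reim_ext; rewrite /cexp !reimE lnK ?posrE// ?cosN ?sinN ?hc ?hs ?mulNr ?opprK mulrC mulfVK ?gt_eqF.
Qed.

End ComplexExponential.

(** * Goursat's theorem by dyadic sums and the mean value estimate *)

Section Goursat.
Context {R : realType}.
Local Notation C := (Cplx R).

(** Completeness of R in the form used for limits: it needs neither a sequence nor a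
filter, so families of approximations can be indexed by anything. *)
Lemma point_between (I : Type) (i0 : I) (a b : I -> R) :
  (forall i j, a i <= b j) -> exists L, forall i, a i <= L /\ L <= b i.
Proof.
move=> ab; have h : has_sup (range a).
  by split; [exists (a i0), i0|exists (b i0) => _ [i _ <-]].
exists (sup (range a)) => i; split; first by apply: ub_le_sup; [exact: h.2|exists i].
by apply: ge_sup; [exact: h.1|move=> _ [j _ <-]].
Qed.

Lemma half_pow_lt (e : R) : 0 < e -> exists n, 2^-1 ^+ n < e.
Proof.
move=> e0; have [n hn] : exists n : nat, e^-1 < n%:R.
  by exists (Num.truncn e^-1).+1; exact: truncnS_gt.
exists n; have n2 : n%:R < (2 : R) ^+ n by rewrite -natrX ltr_nat ltn_expl.
by rewrite exprVn -[e]invrK ltf_pV2 ?posrE ?invr_gt0 ?exprn_gt0// (lt_trans hn).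
Qed.

(** Cousin's lemma: a property of squares that passes from the four quarters to the
whole, and that holds for the small squares around each point, holds for the unit
square; otherwise bisection produces nested squares without the property, and they
shrink to a point. *)
Lemma cousin (P : R -> R -> R -> Prop) :
  (forall x y s, 0 < s -> P x y (s / 2) -> P (x + s / 2) y (s / 2) ->
     P x (y + s / 2) (s / 2) -> P (x + s / 2) (y + s / 2) (s / 2) -> P x y s) ->
  (forall p q, 0 <= p <= 1 -> 0 <= q <= 1 -> exists2 dl, 0 < dl &
     forall x y s, 0 < s -> s < dl -> x <= p <= x + s -> y <= q <= y + s -> P x y s) ->
  P 0 0 1.
Proof.
move=> glue loc; apply: contrapT => nP.
pose Q (t : R * R * R) := ~ P t.1.1 t.1.2 t.2.
have /choice[f hf] : forall t : R * R * R, exists u : R * R * R, 0 < t.2 -> Q t ->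
  [/\ Q u, u.2 = t.2 / 2, t.1.1 <= u.1.1 <= t.1.1 + t.2 / 2 & t.1.2 <= u.1.2 <= t.1.2 + t.2 / 2].
  move=> [[x y] s] /=; have [s0|s0] := ltP 0 s; last by exists (x, y, s).
  apply: contrapT => nex; have h a b : x <= a <= x + s / 2 -> y <= b <= y + s / 2 -> P a b (s / 2).
    by move=> ha hb; apply: contrapT => nPab; apply: nex; exists (a, b, s / 2).
  apply: nex; exists (x, y, s) => _ []; apply: glue => //=; apply: h;
    rewrite ?lexx ?lerDl ?divr_ge0 ?(ltW s0)//.
pose t n := iter n f (0, 0, 1).
have inv n : [/\ Q (t n), (t n).2 = 2^-1 ^+ n & 0 < (t n).2].
  elim: n => [|n [IQ Is I0]]; first by rewrite expr0.
  have [h1 h2 _ _] := hf _ I0 IQ.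
  by rewrite /t iterS -/(t n) h2 divr_gt0// Is exprSr.
have [step1 step2] : (forall n, (t n).1.1 <= (t n.+1).1.1 <= (t n).1.1 + (t n).2 / 2) /\
    (forall n, (t n).1.2 <= (t n.+1).1.2 <= (t n).1.2 + (t n).2 / 2).
  by split=> n; have [IQ Is I0] := inv n; have [_ _ ] := hf _ I0 IQ.
have half n : (t n.+1).2 = (t n).2 / 2 by have [IQ Is I0] := inv n; have [_ ->] := hf _ I0 IQ.
have nest (u : nat -> R) : (forall n, u n <= u n.+1 <= u n + (t n).2 / 2) ->
    exists p, forall n, u n <= p /\ p <= u n + (t n).2.
  move=> hu; apply: (point_between 0%N) => i j.
  have up m k : u m <= u (m + k)%N.
    elim: k => [|k IH]; first by rewrite addn0.
    by rewrite addnS; case/andP: (hu (m + k)%N) => h _; exact: le_trans h.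
  have dn m k : u (m + k)%N + (t (m + k)%N).2 <= u m + (t m).2.
    elim: k => [|k IH]; first by rewrite addn0.
    rewrite addnS half; case/andP: (hu (m + k)%N) => _ h; apply: le_trans IH; lra.
  have tp n : 0 < (t n).2 by case: (inv n).
  have [ij|/ltnW ji] := leqP i j.
    have := up i (j - i)%N; rewrite subnKC// => h.
    by apply: le_trans h _; rewrite lerDl ltW.
  have := dn j (i - j)%N; rewrite subnKC// => h.
  by apply: le_trans h; rewrite lerDl ltW.
have [p hp] := nest _ step1; have [q hq] := nest _ step2.
have p01 : 0 <= p <= 1 by have := hp 0%N; rewrite /t /= add0r => -[-> ->].
have q01 : 0 <= q <= 1 by have := hq 0%N; rewrite /t /= add0r => -[-> ->].
have [dl dl0 hdl] := loc p q p01 q01.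
have [n hn] := half_pow_lt dl0.
have [IQ Is I0] := inv n; apply: IQ; apply: hdl => //; first by rewrite Is.
  by have [-> ->] := hp n.
by have [-> ->] := hq n.
Qed.

(** The average of g over the midpoints of the 2^k dyadic subintervals of
[a, a + s].  Its recursion is the additivity of the integral, and it is exact on
affine functions; nothing more is asked of an integral below. *)
Fixpoint midpoint_avg (k : nat) (g : R -> C) (a s : R) : C :=
  if k is k'.+1 then (midpoint_avg k' g a (s / 2) + midpoint_avg k' g (a + s / 2) (s / 2)) / 2
  else g (a + s / 2).

Lemma cabs2 : cabs (2 : C) = 2. Proof. by rewrite cabs_nat. Qed.

Lemma rc_half (s : R) : rc (s / 2) = rc s / 2.
Proof. by rewrite rcM rcV rc_nat. Qed.

Lemma avg_le k g a s M : 0 <= s ->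
  (forall t, a <= t <= a + s -> cabs (g t) <= M) -> cabs (midpoint_avg k g a s) <= M.
Proof.
elim: k a s => [|k IH] a s s0 h /=.
  by apply: h; rewrite lerDl lerD2l divr_ge0//=; lra.
have h1 : cabs (midpoint_avg k g a (s / 2)) <= M.
  by apply: IH => [|t /andP[t1 t2]]; [lra|apply: h; apply/andP; split; lra].
have h2 : cabs (midpoint_avg k g (a + s / 2) (s / 2)) <= M.
  by apply: IH => [|t /andP[t1 t2]]; [lra|apply: h; apply/andP; split; lra].
rewrite cabsM cabsV cabs2.
have := cabsD (midpoint_avg k g a (s / 2)) (midpoint_avg k g (a + s / 2) (s / 2)); lra.
Qed.

Lemma avgD k g h a s : midpoint_avg k (fun t => g t + h t) a s = midpoint_avg k g a s + midpoint_avg k h a s.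
Proof. by elim: k a s => [|k IH] a s //=; rewrite !IH; ring. Qed.

Lemma avg_affine k (al be : C) a s :
  midpoint_avg k (fun t => al + be * rc t) a s = al + be * rc (a + s / 2).
Proof.
elim: k a s => [|k IH] a s //=; rewrite !IH !(rc_half, rcD).
by field.
Qed.

Lemma avg_cst k (c : C) a s : midpoint_avg k (fun=> c) a s = c.
Proof.
by elim: k a s => [|k IH] a s //=; rewrite !IH; field. Qed.

Variables T S : C.

(** The midpoint sum for the integral of F along the boundary of a square, in a
chart where the tangent vectors of the two sides are T and S. *)
Definition contour_sum k (F : R -> R -> C) x y s : C := rc s *
  (T * (midpoint_avg k (fun t => F t y) x s - midpoint_avg k (fun t => F t (y + s)) x s) +
   S * (midpoint_avg k (fun t => F (x + s) t) y s - midpoint_avg k (fun t => F x t) y s)).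

Lemma contour_split k F x y s : contour_sum k.+1 F x y s =
  contour_sum k F x y (s / 2) + contour_sum k F (x + s / 2) y (s / 2) +
  contour_sum k F x (y + s / 2) (s / 2) + contour_sum k F (x + s / 2) (y + s / 2) (s / 2).
Proof.
have e (a : R) : a + s / 2 + s / 2 = a + s by field.
rewrite /contour_sum /= !e rc_half.
by field.
Qed.

Lemma contourD k F G x y s :
  contour_sum k (fun a b => F a b + G a b) x y s = contour_sum k F x y s + contour_sum k G x y s.
Proof. by rewrite /contour_sum !avgD; ring. Qed.

Lemma contour_affine k (A D : C) x y s :
  contour_sum k (fun a b => A + D * (T * rc a + S * rc b)) x y s = 0.
Proof.
have e1 (b : R) : (fun a => A + D * (T * rc a + S * rc b)) = fun a => (A + D * S * rc b) + (D * T) * rc a.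
  by apply/funext => a; ring.
have e2 (a : R) : (fun b => A + D * (T * rc a + S * rc b)) = fun b => (A + D * T * rc a) + (D * S) * rc b.
  by apply/funext => b; ring.
by rewrite /contour_sum !e1 !e2 !avg_affine !rcD; ring.
Qed.

Lemma contour_le k F x y s M : 0 <= s ->
  (forall a b, x <= a <= x + s -> y <= b <= y + s -> cabs (F a b) <= M) ->
  cabs (contour_sum k F x y s) <= s * (2 * (cabs T + cabs S) * M).
Proof.
move=> s0 h; rewrite /contour_sum cabsM cabs_rc ger0_norm// ler_wpM2l//.
have B (u v : C) : cabs u <= M -> cabs v <= M -> cabs (u - v) <= 2 * M.
  by move=> hu hv; have := cabsB u v; lra.
have inx : x <= x <= x + s by rewrite lexx lerDl.
have inx' : x <= x + s <= x + s by rewrite lexx lerDl s0.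
have iny : y <= y <= y + s by rewrite lexx lerDl.
have iny' : y <= y + s <= y + s by rewrite lexx lerDl s0.
apply: le_trans (cabsD _ _) _; rewrite !cabsM.
have -> : 2 * (cabs T + cabs S) * M = cabs T * (2 * M) + cabs S * (2 * M) by ring.
apply: lerD; apply: ler_wpM2l; rewrite ?cabs_ge0//; apply: B; apply: avg_le => // t ht;
  exact: h.
Qed.

(** Near a point where F is differentiable the contour sum of the affine part is
zero, so the sum over a small square is at most e times its area; Cousin's lemma
adds up these estimates.  The threshold k0 has to be allowed to depend on the
square since subdividing the square costs one level of refinement. *)
Lemma goursat (F : R -> R -> C) :
  (forall p q, exists D, forall e : R, 0 < e -> exists2 dl : R, 0 < dl &
    forall a b, `|a| < dl -> `|b| < dl ->
    cabs (F (p + a) (q + b) - F p q - D * (T * rc a + S * rc b)) <= e * (`|a| + `|b|)) ->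
  forall e : R, 0 < e -> exists k0, forall k, (k0 <= k)%N -> cabs (contour_sum k F 0 0 1) <= e.
Proof.
move=> dF e e0.
suff: exists k0, forall k, (k0 <= k)%N -> cabs (contour_sum k F 0 0 1) <= e * (1 * 1) by rewrite !mulr1.
apply: (@cousin (fun x y s => exists k0, forall k, (k0 <= k)%N ->
  cabs (contour_sum k F x y s) <= e * (s * s))).
  move=> x y s s0 [k1 h1] [k2 h2] [k3 h3] [k4 h4].
  (* the quarters at level k make up the square at level k + 1 *)
  exists (maxn (maxn k1 k2) (maxn k3 k4)).+1 => -[//|k].
  rewrite ltnS !geq_max => /andP[/andP[/h1 b1 /h2 b2] /andP[/h3 b3 /h4 b4]].
  rewrite contour_split.
  apply: le_trans (cabsD _ _) _; apply: le_trans (lerD (cabsD _ _) (lexx _)) _.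
  apply: le_trans (lerD (lerD (cabsD _ _) (lexx _)) (lexx _)) _.
  have -> : e * (s * s) = e * (s / 2 * (s / 2)) + e * (s / 2 * (s / 2)) +
     e * (s / 2 * (s / 2)) + e * (s / 2 * (s / 2)) by field.
  by rewrite !lerD.
move=> p q _ _; have [D hD] := dF p q.
pose K := 4 * (cabs T + cabs S) + 1.
have K0 : 0 < K by have := cabs_ge0 T; have := cabs_ge0 S; rewrite /K; lra.
have [dl dl0 h] := hD (e / K) (divr_gt0 e0 K0).
exists dl => // x y s s0 sdl /andP[xp px] /andP[yq qy]; exists 0%N => k _.
pose A := F p q - D * (T * rc p + S * rc q).
rewrite (_ : F = fun a b => (A + D * (T * rc a + S * rc b)) + (F a b - (A + D * (T * rc a + S * rc b)))); last first.
  by apply/funext => a; apply/funext => b; rewrite addrC subrK.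
rewrite contourD contour_affine add0r.
apply: le_trans (contour_le k (M := e / K * (2 * s)) (ltW s0) _) _.
  move=> a b /andP[a1 a2] /andP[b1 b2].
  have ha : `|a - p| <= s by rewrite ler_norml; apply/andP; split; lra.
  have hb : `|b - q| <= s by rewrite ler_norml; apply/andP; split; lra.
  have := h (a - p) (b - q); rewrite !(addrC _ (_ - _)) !subrK.
  move=> /(_ (le_lt_trans ha sdl) (le_lt_trans hb sdl)).
  rewrite (_ : F a b - F p q - _ = F a b - (A + D * (T * rc a + S * rc b))); last first.
    by rewrite /A !rcB; ring.
  move/le_trans; apply; rewrite ler_wpM2l ?(ltW (divr_gt0 _ _))//; lra.
have -> : s * (2 * (cabs T + cabs S) * (e / K * (2 * s))) = e * (s * s) * (4 * (cabs T + cabs S) / K).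
  by field; rewrite gt_eqF.
rewrite -[leRHS]mulr1 ler_wpM2l ?mulr_ge0 ?(ltW s0) ?(ltW e0)//.
rewrite ler_pdivrMr// /K; lra.
Qed.

End Goursat.

Section MeanValue.
Context {R : realType}.
Local Notation C := (Cplx R).

(** In the coordinate w = log z the disc without its centre is a half-strip of height
2 pi.  By periodicity the contributions of the horizontal sides cancel in the
contour sum, so the averages of f over the circle of radius r and over a tiny circle
are close, and the latter is close to f 0.  The origin is not in the image of the
chart, which is why f is only required to be continuous there. *)
Theorem mean_value_bound (f : C -> C) (r M : R) : 0 < r ->
  (forall z : C, z != 0 -> derivable f z 1) ->
  (forall e : R, 0 < e -> exists2 dl : R, 0 < dl & forall s, cabs s < dl -> cabs (f s - f 0) <= e) ->
  (forall z, cabs z = r -> cabs (f z) <= M) -> cabs (f 0) <= M.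
Proof.
move=> r0 df cf fM; apply/ler_addgt0Pr => e e0.
have e20 : 0 < e / 2 by rewrite divr_gt0.
have [dl dl0 hdl] := cf _ e20.
(* r e^(-T) < dl, so the left side of the strip lies in the disc where f is
   close to f 0. *)
pose T := r / dl; have T0 : 0 < T by rewrite divr_gt0.
pose S : R := pi *+ 2; have S0 : 0 < S by rewrite mulrn_wgt0// pi_gt0.
pose w x y : C := mkc (T * (x - 1)) (S * y).
pose g (v : C) := f (rc r * cexp v).
pose F x y := g (w x y).
have wE p q a b : w (p + a) (q + b) = w p q + (rc T * rc a + mkc 0 S * rc b).
  by apply: reim_ext; rewrite /w !reimE; ring.
have arg v : rc r * cexp v != 0 by rewrite mulf_neq0 ?cexp_neq0// rc_eq0 gt_eqF.
have dg (v : C) : exists D : C, is_derive v 1 g D.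
  have h := cderivM (cderiv_cst (rc r) v) (cderiv_cexp v).
  have := cderiv_comp h (cder_ex (df _ (arg v))).
  by eexists; eassumption.
have argn x y : cabs (rc r * cexp (w x y)) = r * expR (T * (x - 1)).
  by rewrite cabsM cabs_cexp cabs_rc gtr0_norm.
have [k0 /(_ k0 (leqnn _))] : exists k0, forall k, (k0 <= k)%N ->
    cabs (contour_sum (rc T) (mkc 0 S) k F 0 0 1) <= S * (e / 2).
  apply: goursat; last by rewrite mulr_gt0.
  move=> p q; have [D hD] := dg (w p q); exists D => e1 e10.
  pose K := T + S + 1; have K0 : 0 < K by rewrite /K; lra.
  have [d d0 hd] := (cderivP _ _ _).1 hD _ (divr_gt0 e10 K0).
  exists (d / (2 * K)); first by rewrite divr_gt0// mulr_gt0.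
  move=> a b ha hb.
  have hn : cabs (rc T * rc a + mkc 0 S * rc b) <= K * (`|a| + `|b|).
    apply: le_trans (cabsD _ _) _; rewrite !cabsM !cabs_rc.
    rewrite (_ : cabs (mkc 0 S) = S); last first.
      by rewrite /cabs !reimE expr0n add0r sqrtr_sqr gtr0_norm.
    rewrite (gtr0_norm T0) mulrDr; have a0 := normr_ge0 a; have b0 := normr_ge0 b.
    by apply: lerD; apply: ler_wpM2r => //; rewrite /K; lra.
  rewrite /F wE; apply: le_trans (hd _ _) _.
    apply: le_lt_trans hn _; move: ha hb; rewrite !ltr_pdivlMr ?mulr_gt0//; lra.
  apply: le_trans (ler_wpM2l (ltW (divr_gt0 e10 K0)) hn) _.
  by rewrite mulrA mulfVK// gt_eqF.
rewrite /contour_sum rc1 mul1r add0r.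
have per t : F t 1 = F t 0.
  rewrite /F /g /w mulr1 mulr0 cexp_2pi //.
rewrite (_ : (fun t => F t 1) = (fun t => F t 0)); last exact/funext/per.
rewrite subrr mulr0 add0r cabsM.
rewrite (_ : cabs (mkc 0 S) = S); last first.
  by rewrite /cabs !reimE expr0n add0r sqrtr_sqr gtr0_norm.
rewrite ler_pM2l//; set a1 := midpoint_avg _ _ _ _; set a0 := midpoint_avg _ _ _ _ => h.
have h1 : cabs a1 <= M.
  apply: avg_le => // y _; apply: fM.
  by rewrite argn subrr mulr0 expR0 mulr1.
have h0 : cabs (a0 - f 0) <= e / 2.
  rewrite -[X in a0 - X](avg_cst k0 (f 0) 0 1) /a0.
  rewrite -[X in _ - X]mul1r -mulNr.
  have -> : -1 * midpoint_avg k0 (fun=> f 0) 0 1 = midpoint_avg k0 (fun=> - f 0) 0 1 by rewrite !avg_cst mulN1r.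
  rewrite -avgD; apply: avg_le => // y _; apply: hdl.
  rewrite argn sub0r mulrN1 expRN ltr_pdivrMr ?expR_gt0//.
  rewrite mulrC -ltr_pdivrMr// -/T.
  by apply: lt_le_trans (expR_ge1Dx T); rewrite ltrDr.
have := cabs_tri a0 0 (f 0); rewrite !sub0r !cabsN.
have := cabs_sub a0 (a1 - (a1 - a0)); have := cabs_sub (f 0) a0; rewrite (cabsC (f 0)).
have := cabs_sub a0 a1; rewrite (cabsC a0); lra.
Qed.

End MeanValue.

(** * Cauchy estimates *)

Section CauchyTheory.
Context {R : realType}.
Local Notation C := (Cplx R).
Implicit Types (f g : C -> C) (z : C).

(** Convergence with an explicit rate, for families with an arbitrary index: the
intervals with centre re (Q i) and radius e i meet pairwise, hence have a common
point, and likewise for imaginary parts. *)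
Lemma complete_cauchy (I : Type) (i0 : I) (Q : I -> C) (e : I -> R) :
  (forall i j, cabs (Q i - Q j) <= e i + e j) ->
  exists d, forall i, cabs (Q i - d) <= 2 * e i.
Proof.
move=> h.
have [x hx] : exists x, forall i, re (Q i) - e i <= x /\ x <= re (Q i) + e i.
  apply: (point_between i0) => i j; have := h i j; have := re_le (Q i - Q j).
  by rewrite reB; have := ler_norm (re (Q i) - re (Q j)); lra.
have [y hy] : exists x, forall i, im (Q i) - e i <= x /\ x <= im (Q i) + e i.
  apply: (point_between i0) => i j; have := h i j; have := im_le (Q i - Q j).
  by rewrite imB; have := ler_norm (im (Q i) - im (Q j)); lra.
exists (mkc x y) => i; apply: le_trans (cabs_le _) _; rewrite !reimE.
have [x1 x2] := hx i; have [y1 y2] := hy i.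
have -> : 2 * e i = e i + e i by ring.
by apply: lerD; rewrite ler_norml; apply/andP; split; lra.
Qed.

(** Boundedness of a locally bounded function on a square is an instance of Cousin's
lemma. *)
Lemma entire_bounded f z0 r : entire f ->
  exists M, forall z, cabs (z - z0) <= r -> cabs (f z) <= M.
Proof.
move=> hf; have [r0|r0] := ltP r 0.
  by exists 0 => z h; have := cabs_ge0 (z - z0); lra.
pose phi x y : C := z0 + mkc (r * (2 * x - 1)) (r * (2 * y - 1)).
suff [M hM] : exists M, forall a b, 0 <= a <= 0 + 1 -> 0 <= b <= 0 + 1 -> cabs (f (phi a b)) <= M.
  have [r00|rp] := eqVneq r 0.
    exists (cabs (f z0)) => z; rewrite r00 => h.
    have /eqP : cabs (z - z0) = 0 by apply/eqP; rewrite eq_le h cabs_ge0.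
    by rewrite cabs_eq0 subr_eq0 => /eqP ->.
  have {r0}rp : 0 < r by rewrite lt_def rp.
  exists M => z h.
  have -> : z = phi ((re (z - z0) / r + 1) / 2) ((im (z - z0) / r + 1) / 2).
    rewrite /phi -[LHS](subrK z0) addrC; congr (_ + _).
    by apply: reim_ext; rewrite !reimE; field; rewrite gt_eqF.
  have nb (x : R) : `|x| <= cabs (z - z0) -> 0 <= (x / r + 1) / 2 <= 0 + 1.
    move=> hx; have : `|x / r| <= 1.
      by rewrite normrM normfV (gtr0_norm rp) ler_pdivrMr// mul1r (le_trans hx).
    by rewrite ler_norml => /andP[h1 h2]; apply/andP; split; lra.
  by apply: hM; apply: nb; [exact: re_le|exact: im_le].
apply: (@cousin R (fun x y s => exists M, forall a b, x <= a <= x + s -> y <= b <= y + s -> cabs (f (phi a b)) <= M)).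
  move=> x y s s0 [M1 h1] [M2 h2] [M3 h3] [M4 h4].
  exists (Num.max (Num.max M1 M2) (Num.max M3 M4)) => a b /andP[a1 a2] /andP[b1 b2].
  rewrite !le_max.
  have [ax|ax] := leP a (x + s / 2); have [bx|bx] := leP b (y + s / 2).
  - by rewrite h1//; apply/andP; split; lra.
  - by rewrite h3 ?orbT//; apply/andP; split; lra.
  - by rewrite h2 ?orbT//; apply/andP; split; lra.
  - by rewrite h4 ?orbT//; apply/andP; split; lra.
move=> p q _ _.
have [dl dl0 h] := cder_cont (hf (phi p q)) ltr01.
exists (dl / (4 * r + 1)); first by rewrite divr_gt0//; lra.
move=> x y s s0 sdl /andP[xp px] /andP[yq qy]; exists (cabs (f (phi p q)) + 1) => a b /andP[a1 a2] /andP[b1 b2].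
have -> : phi a b = phi p q + mkc (r * (2 * (a - p))) (r * (2 * (b - q))).
  by rewrite /phi -addrA; congr (_ + _); apply: reim_ext; rewrite !reimE; ring.
have := h (mkc (r * (2 * (a - p))) (r * (2 * (b - q)))).
set w := mkc _ _ => hw.
have : cabs w < dl.
  apply: le_lt_trans (cabs_le _) _; rewrite !reimE !normrM !(ger0_norm r0) !normr_nat.
  have ha : `|a - p| <= s by rewrite ler_norml; apply/andP; split; lra.
  have hb : `|b - q| <= s by rewrite ler_norml; apply/andP; split; lra.
  move: sdl; rewrite ltr_pdivlMr; last by lra.
  have := ler_wpM2l r0 ha; have := ler_wpM2l r0 hb; lra.
move=> /hw; have := cabs_sub (f (phi p q + w)) (f (phi p q)); lra.
Qed.

(** Cousin's lemma applied to the first coordinate only: increments are additive,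
and on short segments they are controlled by the derivative. *)
Lemma mvt_bound g (a b : C) (K : R) :
  (forall t : R, 0 <= t <= 1 -> derivable g (a + rc t * (b - a)) 1 /\
     cabs (cder g (a + rc t * (b - a))) <= K) ->
  cabs (g b - g a) <= K * cabs (b - a).
Proof.
move=> h; set L := cabs (b - a); have L0 : 0 <= L by exact: cabs_ge0.
have K0 : 0 <= K by have [|_] := h 0; [rewrite lexx ler01|apply/le_trans/cabs_ge0].
apply/ler_addgt0Pr => e e0.
pose e1 := e / (L + 1).
have e10 : 0 < e1 by rewrite divr_gt0//; lra.
have e1L : e1 * L <= e.
  rewrite /e1 mulrAC ler_pdivrMr; last by lra.
  by rewrite ler_wpM2l ?(ltW e0)//; lra.
pose ga (t : R) : C := a + rc t * (b - a).
suff : cabs (g (ga (0 + 1)) - g (ga 0)) <= (K + e1) * 1 * L.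
  rewrite add0r /ga rc1 rc0 mul1r mul0r addr0 (addrC a) subrK; lra.
apply: (@cousin R (fun x y s => cabs (g (ga (x + s)) - g (ga x)) <= (K + e1) * s * L)).
  move=> x y s s0 h1 h2 _ _.
  have e2 : x + s / 2 + s / 2 = x + s by field.
  have := cabs_tri (g (ga (x + s / 2))) (g (ga (x + s))) (g (ga x)).
  rewrite e2 in h2; move: h1 h2.
  have -> : (K + e1) * (s / 2) * L = (K + e1) * s * L / 2 by ring.
  lra.
move=> p q /h [dg dK] _; rewrite -/(ga p) in dg dK.
have [dl dl0 hd] := (cderivP _ _ _).1 (cder_ex dg) _ e10.
exists (dl / (L + 1)); first by rewrite divr_gt0//; lra.
move=> x _ s s0 sdl /andP[xp px] _.
have sL : s * L < dl.
  move: sdl; rewrite ltr_pdivlMr; last by lra.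
  by move: s0; lra.
pose D := cder g (ga p); have gaE t : ga t = ga p + rc (t - p) * (b - a).
  by rewrite /ga rcB; ring.
have E t : x <= t <= x + s ->
   cabs (g (ga t) - g (ga p) - D * (rc (t - p) * (b - a))) <= e1 * (`|t - p| * L).
  move=> /andP[t1 t2]; rewrite gaE.
  have tn : `|t - p| <= s by rewrite ler_norml; apply/andP; split; lra.
  have := hd (rc (t - p) * (b - a)); rewrite cabsM cabs_rc -/L; apply.
  by apply: le_lt_trans sL; rewrite ler_wpM2r.
have i1 : x <= x + s <= x + s by rewrite lexx lerDl ltW.
have i2 : x <= x <= x + s by rewrite lexx lerDl ltW.
have E1 := E _ i1; have E2 := E _ i2.
rewrite (ger0_norm (x := x + s - p)) ?subr_ge0// in E1.
rewrite (ler0_norm (x := x - p)) ?subr_le0// in E2.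
have -> : g (ga (x + s)) - g (ga x) = (g (ga (x + s)) - g (ga p) - D * (rc (x + s - p) * (b - a)))
  - (g (ga x) - g (ga p) - D * (rc (x - p) * (b - a))) + D * (rc s * (b - a)).
  by rewrite !rcB rcD; ring.
apply: le_trans (cabsD _ _) _; rewrite !cabsM cabs_rc -/L (gtr0_norm s0).
have := cabsB (g (ga (x + s)) - g (ga p) - D * (rc (x + s - p) * (b - a)))
  (g (ga x) - g (ga p) - D * (rc (x - p) * (b - a))).
have : cabs D * (s * L) <= K * (s * L) by rewrite ler_wpM2r// mulr_ge0// ltW.
lra.
Qed.

Lemma cderiv_local f g z d (d0 : R) : 0 < d0 ->
  (forall s, cabs s < d0 -> f (z + s) = g (z + s)) ->
  is_derive z 1 f d -> is_derive z 1 g d.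
Proof.
move=> d00 fg /cderivP h; apply/cderivP => e /h[dl dl0 hd].
exists (Num.min d0 dl) => [|s]; first by rewrite lt_min d00.
rewrite lt_min => /andP[s1 s2]; rewrite -fg// -[X in g X](addr0 z) -fg ?addr0 ?cabs0//.
exact: hd.
Qed.

Lemma entire_shift f (a : C) : entire f -> entire (fun s => f (a + s)).
Proof.
by move=> hf; apply: (entire_comp hf); apply: entireD; [exact: entire_cst|exact: entire_id].
Qed.

Lemma cder_shift f a z : entire f -> cder (fun s => f (a + s)) z = cder f (a + z).
Proof.
move=> hf; apply: cder_val; rewrite -[cder f _]mulr1.
rewrite -[X in _ * X]add0r.
by apply: (cderiv_comp _ (cder_ex (hf _))); exact: cderivD (cderiv_cst a z) (cderiv_id z).
Qed.

(** Removing a zero at the origin; iterating it produces the Taylor coefficients. *)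
Definition dq f z : C := if z == 0 then cder f 0 else (f z - f 0) / z.

Lemma dq0 f : dq f 0 = cder f 0. Proof. by rewrite /dq eqxx. Qed.

Lemma dqE f z : f z = f 0 + z * dq f z.
Proof.
rewrite /dq; case: eqP => [->|/eqP z0]; first by rewrite mul0r addr0.
by rewrite mulrC mulfVK// addrC subrK.
Qed.

Lemma dq_derivable f z : entire f -> z != 0 -> derivable (dq f) z 1.
Proof.
move=> hf z0.
have h := cderivM (cderivB (cder_ex (hf z)) (cderiv_cst (f 0) z)) (cderivV z0 (cderiv_id z)).
have zn : 0 < cabs z by rewrite cabs_gt0.
apply: is_derive_derivable (cderiv_local zn _ h) => s hs.
rewrite /dq; case: eqP => // /eqP; rewrite addrC addr_eq0 => /eqP sz.
by move: hs; rewrite sz cabsN ltxx.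
Qed.

Lemma dq_cont f : entire f -> forall e : R, 0 < e -> exists2 dl : R, 0 < dl &
  forall s, cabs s < dl -> cabs (dq f s - dq f 0) <= e.
Proof.
move=> hf e e0; have [dl dl0 h] := (cderivP _ _ _).1 (cder_ex (hf 0)) _ e0.
exists dl => // s sdl.
have [->|s0] := eqVneq s 0; first by rewrite subrr cabs0 ltW.
have := h s sdl; rewrite add0r (dqE f s) (addrC (f 0)) addrK -dq0.
by rewrite (mulrC _ s) -mulrBr cabsM mulrC ler_pM2r ?cabs_gt0.
Qed.

Lemma max_center f z (r M : R) : entire f -> 0 < r ->
  (forall s, cabs s = r -> cabs (f (z + s)) <= M) -> cabs (f z) <= M.
Proof.
move=> hf r0 h; rewrite -[z]addr0.
apply: (@mean_value_bound R (fun s => f (z + s)) r M) => // [s _|e e0].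
  exact: entire_shift.
have [dl dl0 hd] := cder_cont (hf z) e0.
by exists dl => // s /hd; rewrite addr0.
Qed.

Lemma dq_max f (r M : R) : entire f -> 0 < r ->
  (forall s, cabs s = r -> cabs (dq f s) <= M) -> cabs (dq f 0) <= M.
Proof.
move=> hf r0 h; apply: (mean_value_bound r0) => //.
  by move=> z; exact: dq_derivable.
exact: dq_cont.
Qed.

(** The mean value estimate for the difference quotient of f at z, which is
continuous at the centre of the circle; the factor 2 comes from bounding f z as well. *)
Lemma cauchy_est f z (r M : R) : entire f -> 0 < r ->
  (forall s, cabs s = r -> cabs (f (z + s)) <= M) -> cabs (cder f z) <= 2 * M / r.
Proof.
move=> hf r0 h; have h0 := max_center hf r0 h.
rewrite -[z]addr0 -(cder_shift z 0 hf) -dq0.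
apply: (dq_max _ r0); first exact: entire_shift.
move=> s sr; rewrite /dq ifN; last by rewrite -cabs_gt0 sr.
rewrite cabsM cabsV sr ler_pM2r ?invr_gt0// addr0.
by have := cabsB (f (z + s)) (f z); have := h s sr; lra.
Qed.

End CauchyTheory.

(** * Derivatives and difference quotients are entire *)

Section Regularity.
Context {R : realType}.
Local Notation C := (Cplx R).
Implicit Types (f g : C -> C) (z : C).

Definition quot (h : C) f z : C := (f (z + h) - f z) / h.

Lemma entire_quot h f : entire f -> entire (quot h f).
Proof.
move=> hf; apply: entireM; last exact: entire_cst.
apply: (entireB _ hf); apply: (entire_comp hf).
by apply: entireD; [exact: entire_id|exact: entire_cst].
Qed.

Lemma cder_quot h f z : entire f -> cder (quot h f) z = quot h (cder f) z.
Proof.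
move=> hf; have h1 : is_derive z 1 (fun x => f (x + h)) (cder f (z + h)).
  have := cder_shift h z hf; rewrite (addrC h) => <-.
  rewrite (_ : (fun x => f (x + h)) = fun x => f (h + x)); last by apply/funext => x; rewrite addrC.
  by apply: cder_ex; exact: entire_shift.
rewrite (cder_val (cderivM (cderivB h1 (cder_ex (hf z))) (cderiv_cst h^-1 z))).
by rewrite mulr0 addr0.
Qed.

Lemma quotM h f z : h != 0 -> f (z + h) - f z = quot h f z * h.
Proof. by move=> h0; rewrite mulfVK. Qed.

Lemma cder_sublinear g z (c : C) : entire g ->
  cder (fun s => g s - c * s) z = cder g z - c.
Proof.
move=> hg; rewrite (cder_val (cderivB (cder_ex (hg z)) (cderivM (cderiv_cst c z) (cderiv_id z)))).
by rewrite mul0r add0r mulr1.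
Qed.

Lemma entire_sublinear g (c : C) : entire g -> entire (fun s => g s - c * s).
Proof.
by move=> hg; apply: (entireB hg); apply: entireM; [exact: entire_cst|exact: entire_id].
Qed.

Lemma cabs_seg (t : R) (w : C) : 0 <= t <= 1 -> cabs (rc t * w) <= cabs w.
Proof.
move=> /andP[t0 t1]; rewrite cabsM cabs_rc ger0_norm// -[leRHS]mul1r.
by rewrite ler_wpM2r ?cabs_ge0.
Qed.

(** The difference quotients of f with increment h are entire and bounded near z0, so
the Cauchy estimates make the derivative of f Lipschitz there.  Therefore these
quotients converge to the derivative of f at the rate O(h), and a second use of the
Cauchy estimates makes the difference quotients of the derivative at z0 a Cauchy
family. *)
Theorem entire_cder f : entire f -> entire (cder f).
Proof.
move=> hf z0.
have [M0 hM0] := entire_bounded z0 4 hf.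
pose M := Num.max M0 0; have M_ge0 : 0 <= M by rewrite le_max lexx orbT.
have hM z : cabs (z - z0) <= 4 -> cabs (f z) <= M by move=> /hM0 h; rewrite le_max h.
have tri z s : cabs (z + s - z0) <= cabs (z - z0) + cabs s by rewrite addrAC cabsD.
have ha z : cabs (z - z0) <= 2 -> cabs (cder f z) <= M.
  move=> hz; have := @cauchy_est R f z 2 M hf; rewrite (mulrC 2) mulfK//; apply=> //.
  by move=> s hs; apply: hM; have := tri z s; lra.
have hb z h : cabs (z - z0) <= 1 -> cabs h <= 1 -> cabs (f (z + h) - f z) <= M * cabs h.
  move=> hz hh; have := @mvt_bound R f z (z + h) M; rewrite (addrC z h) addrK; apply=> t ht.
  split=> //; apply: ha; have := tri z (rc t * h); have := cabs_seg h ht; lra.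
have hc z h : cabs (z - z0) <= 2^-1 -> cabs h <= 1 ->
    cabs (cder f (z + h) - cder f z) <= 4 * M * cabs h.
  move=> hz hh; have [->|h0] := eqVneq h 0; first by rewrite addr0 subrr cabs0 mulr0.
  rewrite quotM// -cder_quot// cabsM ler_wpM2r ?cabs_ge0//.
  have := @cauchy_est R (quot h f) z 2^-1 M (@entire_quot h f hf).
  rewrite invrK (_ : 2 * M * 2 = 4 * M); last by ring.
  apply=> [//|s hs]; have := hb (z + s) h; have := tri z s.
  rewrite quotM// cabsM => t1 t2; rewrite -(@ler_pM2r _ (cabs h)) ?cabs_gt0//; apply: t2 => //.
  by lra.
have hd z h : cabs (z - z0) <= 2^-1 -> cabs h <= 1 -> h != 0 ->
    cabs (quot h f z - cder f z) <= 4 * M * cabs h.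
  move=> hz hh h0; rewrite -(@ler_pM2r _ (cabs h)) ?cabs_gt0// -cabsM mulrBl -quotM//.
  have hg := @entire_sublinear _ (cder f z) (@entire_shift R f z hf).
  have := @mvt_bound R (fun s => f (z + s) - cder f z * s) 0 h (4 * M * cabs h).
  rewrite subr0 addr0 mulr0 subr0 addrAC; apply=> t ht; split=> //.
  rewrite add0r cder_sublinear; last exact: entire_shift.
  rewrite cder_shift//; have th := cabs_seg h ht.
  apply: le_trans (hc _ _ hz _) _; first by lra.
  by rewrite ler_wpM2l// mulr_ge0.
(* [complete_cauchy] is indexed by the increments themselves, so no sequence of
   increments has to be chosen. *)
pose I := {h : C | cabs h <= 1 /\ h != 0}.
have i1 : cabs (1 : C) <= 1 /\ (1 : C) != 0 by rewrite cabs1 oner_neq0.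
have he (i j : I) : cabs (quot (sval i) (cder f) z0 - quot (sval j) (cder f) z0) <=
    16 * M * cabs (sval i) + 16 * M * cabs (sval j).
  case: i => h [h1 h0]; case: j => l [l1 l0] /=.
  have E : cder (fun z => quot h f z - quot l f z) z0 = quot h (cder f) z0 - quot l (cder f) z0.
    rewrite -!cder_quot//.
    exact: cder_val (cderivB (cder_ex (@entire_quot h f hf z0)) (cder_ex (@entire_quot l f hf z0))).
  rewrite -E; have := @cauchy_est R _ z0 2^-1 (4 * M * cabs h + 4 * M * cabs l) (entireB (@entire_quot h f hf) (@entire_quot l f hf)).
  rewrite invrK; have -> : 2 * (4 * M * cabs h + 4 * M * cabs l) * 2 = 16 * M * cabs h + 16 * M * cabs l by ring.
  apply=> [//|s hs].
  have hz : cabs (z0 + s - z0) <= 2^-1 by rewrite addrC addKr hs.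
  apply: le_trans (cabs_tri (cder f (z0 + s)) _ _) _; rewrite (cabsC (cder f (z0 + s))).
  by apply: lerD; apply: hd.
have [d hQ] := complete_cauchy (exist _ 1 i1 : I) he.
apply: (@is_derive_derivable R _ z0 d); apply/cderivP => e e0.
have K0 : 0 < 32 * M + 1 by lra.
exists (Num.min 1 (e / (32 * M + 1))); first by rewrite lt_min ltr01 divr_gt0.
move=> s; rewrite lt_min ltr_pdivlMr// => /andP[s1 s2].
have [->|s0] := eqVneq s 0; first by rewrite addr0 subrr mulr0 subr0 cabs0 mulr0.
rewrite quotM// -mulrBl cabsM ler_wpM2r ?cabs_ge0//.
apply: le_trans (hQ (exist _ s (conj (ltW s1) s0))) _ => /=.
have := cabs_ge0 s; lra.
Qed.

(** At the origin this needs the Taylor expansion of f to second order, which follows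
from the mean value inequality since the derivative of f is differentiable. *)
Theorem entire_dq f : entire f -> entire (dq f).
Proof.
move=> hf z; have [->|] := eqVneq z 0; last exact: dq_derivable.
have hf' := entire_cder hf; pose D := cder (cder f) 0.
apply: (@is_derive_derivable R _ 0 (D / 2)); apply/cderivP => e e0.
have [dl dl0 hd] := (cderivP _ _ _).1 (cder_ex (hf' 0)) _ e0.
exists dl => // h hdl; rewrite add0r.
have [->|h0] := eqVneq h 0; first by rewrite subrr mulr0 subr0 cabs0 mulr0.
have dg (s : C) : is_derive s 1 (fun s : C => f s - cder f 0 * s - D / 2 * (s * s))
    (cder f s - (0 * s + cder f 0 * 1) - (0 * (s * s) + D / 2 * (1 * s + s * 1))).
  apply: cderivB; first apply: cderivB.
  - exact: cder_ex.
  - exact: cderivM (cderiv_cst _ _) (cderiv_id _).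
  - exact: cderivM (cderiv_cst _ _) (cderivM (cderiv_id _) (cderiv_id _)).
have := @mvt_bound R (fun s => f s - cder f 0 * s - D / 2 * (s * s)) 0 h (e * cabs h).
rewrite subr0 => hm.
have {hm} : cabs (f h - cder f 0 * h - D / 2 * (h * h) - (f 0 - cder f 0 * 0 - D / 2 * (0 * 0))) <=
  e * cabs h * cabs h.
  apply: hm => t ht; split; first exact: is_derive_derivable (dg _).
  rewrite (cder_val (dg _)) add0r; have th := cabs_seg h ht.
  have alg (w A B E : C) : A - (0 * w + B * 1) - (0 * (w * w) + E / 2 * (1 * w + w * 1)) = A - B - E * w.
    by field.
  rewrite alg -[X in cder f X - _]add0r.
  apply: le_trans (hd _ (le_lt_trans th hdl)) _.
  by rewrite ler_wpM2l// ltW.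
have alg (w A B A' E : C) : w != 0 -> A - A' * w - E / 2 * (w * w) - (B - A' * 0 - E / 2 * (0 * 0)) =
    ((A - B) / w - A' - E / 2 * w) * w by move=> w0; field.
rewrite (alg _ _ _ _ _ h0) dq0 {1}/dq (negPf h0).
by rewrite cabsM ler_pM2r ?cabs_gt0.
Qed.

End Regularity.

(** * Taylor coefficients *)

Section TaylorCoefficients.
Context {R : realType}.
Local Notation C := (Cplx R).
Implicit Types (f g : C -> C) (z : C) (n : nat).

(** The n-th Taylor remainder divided by z ^ n; its value at 0 is the n-th Taylor
coefficient. *)
Definition dqn n f : C -> C := iter n dq f.
Definition tcoef n f : C := dqn n f 0.

Lemma dqnS n f : dqn n.+1 f = dqn n (dq f). Proof. exact: iterSr. Qed.
Lemma tcoefS n f : tcoef n.+1 f = tcoef n (dq f). Proof. by rewrite /tcoef dqnS. Qed.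

Lemma entire_dqn n f : entire f -> entire (dqn n f).
Proof. by move=> hf; elim: n => [|n IH]; [exact: hf|exact: entire_dq IH]. Qed.

Lemma taylor n f z :
  f z = \sum_(m < n) tcoef m f * z ^+ m + z ^+ n * dqn n f z.
Proof.
elim: n => [|n IH]; first by rewrite big_ord0 add0r expr0 mul1r.
rewrite big_ord_recr /= {1}IH -addrA; congr (_ + _).
rewrite {1}(dqE (dqn n f) z) mulrDr; congr (_ + _); first by rewrite mulrC.
by rewrite exprSr mulrA.
Qed.

Lemma dqD f g : entire f -> entire g -> dq (fun z => f z + g z) = fun z => dq f z + dq g z.
Proof.
move=> hf hg; apply/funext => z; rewrite /dq; case: eqP => _.
  exact: cder_val (cderivD (cder_ex (hf 0)) (cder_ex (hg 0))).
by rewrite -mulrDl; congr (_ / _); ring.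
Qed.

Lemma cderZ (c : C) f z : entire f -> cder (fun z => c * f z) z = c * cder f z.
Proof.
move=> hf; rewrite (cder_val (cderivM (cderiv_cst c z) (cder_ex (hf z)))).
by rewrite mul0r add0r.
Qed.

Lemma entireZ (c : C) f : entire f -> entire (fun z => c * f z).
Proof. by move=> hf; apply: (entireM (@entire_cst R c) hf). Qed.

Lemma dqZ (c : C) f : entire f -> dq (fun z => c * f z) = fun z => c * dq f z.
Proof.
move=> hf; apply/funext => z; rewrite /dq; case: eqP => _; first exact: cderZ.
by rewrite -mulrBr mulrA.
Qed.

Lemma tcoefD n f g : entire f -> entire g ->
  tcoef n (fun z => f z + g z) = tcoef n f + tcoef n g.
Proof.
elim: n f g => [//|n IH] f g hf hg; rewrite !tcoefS dqD//.
by apply: IH; exact: entire_dq.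
Qed.

Lemma tcoefZ n (c : C) f : entire f -> tcoef n (fun z => c * f z) = c * tcoef n f.
Proof.
elim: n f => [//|n IH] f hf; rewrite !tcoefS dqZ//.
by apply: IH; exact: entire_dq.
Qed.

Lemma dq_mulX f : entire f -> dq (fun z => z * f z) = f.
Proof.
move=> hf; apply/funext => z; rewrite /dq; case: eqP => [->|/eqP z0].
  rewrite (cder_val (cderivM (cderiv_id 0) (cder_ex (hf 0)))).
  by rewrite mul0r addr0 mul1r.
by rewrite mul0r subr0 mulrC mulKf.
Qed.

Lemma tcoef_mulX n f : entire f -> tcoef n.+1 (fun z => z * f z) = tcoef n f.
Proof. by move=> hf; rewrite tcoefS dq_mulX. Qed.

Lemma tcoef_cst n (c : C) : tcoef n.+1 (fun=> c) = 0.
Proof.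
have h m : tcoef m (fun=> 0 : C) = 0.
  elim: m => [//|m IH]; rewrite tcoefS (_ : dq _ = fun=> 0)//.
  by apply/funext => z; rewrite /dq subrr mul0r (cder_val (cderiv_cst 0 0)) if_same.
rewrite tcoefS (_ : dq _ = fun=> 0) ?h//.
by apply/funext => z; rewrite /dq subrr mul0r (cder_val (cderiv_cst c 0)) if_same.
Qed.

Lemma cder_dq f : entire f -> cder f = fun z => dq f z + z * cder (dq f) z.
Proof.
move=> hf; apply/funext => z; have hd := entire_dq hf.
rewrite -[in LHS](_ : (fun z => f 0 + z * dq f z) = f); last first.
  by apply/funext => x; rewrite -dqE.
rewrite (cder_val (cderivD (cderiv_cst _ z) (cderivM (cderiv_id z) (cder_ex (hd z))))).
by rewrite add0r mul1r.
Qed.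

Lemma tcoef_cder n f : entire f -> tcoef n (cder f) = n.+1%:R * tcoef n.+1 f.
Proof.
elim: n f => [|n IH] f hf; first by rewrite mul1r /tcoef /= dq0.
have hd := entire_dq hf.
have hx : entire (fun z => z * cder (dq f) z) := entireM (@entire_id R) (entire_cder hd).
rewrite cder_dq// tcoefD// tcoef_mulX; last exact: entire_cder.
rewrite IH// -!tcoefS.
by rewrite !mulr_natl [in RHS]mulrS.
Qed.

(** Each difference quotient costs a factor 2 / d on the annulus, because the value
at the centre is bounded by the supremum over the inner circle. *)
Lemma dqn_bound f (d rho M : R) n : entire f -> 0 < d -> d <= rho ->
  (forall z, d <= cabs z <= rho -> cabs (f z) <= M) ->
  forall z, d <= cabs z <= rho -> cabs (dqn n f z) <= M * (2 / d) ^+ n.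
Proof.
move=> hf d0 dr hM; elim: n => [|n IH] z hz; first by rewrite expr0 mulr1 hM.
have z0 : z != 0 by rewrite -cabs_gt0; case/andP: hz => + _; exact: lt_le_trans.
set B := M * _ in IH.
have g0 : cabs (dqn n f 0) <= B.
  by apply: (@max_center R (dqn n f) 0 d _ (@entire_dqn n f hf) d0) => s sd; rewrite add0r IH// sd lexx.
have B0 : 0 <= B by apply: le_trans g0; exact: cabs_ge0.
rewrite /dqn iterS -/(dqn n f) /dq (negPf z0) cabsM cabsV.
have -> : M * (2 / d) ^+ n.+1 = (2 * B) / d by rewrite exprSr /B; ring.
have zd : d <= cabs z by case/andP: hz.
apply: ler_pM; rewrite ?cabs_ge0 ?invr_ge0 ?cabs_ge0//.
  by have := cabsB (dqn n f z) (dqn n f 0); have := IH z hz; lra.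
by rewrite lef_pV2// posrE ?cabs_gt0.
Qed.

Lemma tcoef_le f (r M : R) n : entire f -> 0 < r ->
  (forall z, cabs z = r -> cabs (f z) <= M) -> cabs (tcoef n f) <= M * (2 / r) ^+ n.
Proof.
move=> hf r0 hM; apply: (@max_center R (dqn n f) 0 r _ (@entire_dqn n f hf) r0) => s sr.
rewrite add0r; apply: (@dqn_bound f r r M n hf r0 (lexx r)) => [z|]; last by rewrite sr lexx.
by rewrite -eq_le => /eqP/esym/hM.
Qed.

(** The radius 5 rho + 1 keeps a circle around z at a distance at least 4 rho + 1 from
the origin, where each difference quotient gains a factor 2 / (4 rho + 1). *)
Lemma taylor_remainder f (rho : R) : entire f -> 0 <= rho ->
  exists M, forall n z, cabs z <= rho -> cabs (z ^+ n * dqn n f z) <= M * 2^-1 ^+ n.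
Proof.
move=> hf r0; have [M hM] := entire_bounded 0 (6 * rho + 1) hf.
have M0 : 0 <= M.
  apply: le_trans (hM 0 _); first exact: cabs_ge0.
  by rewrite subrr cabs0; lra.
exists M => n z hz; have d0 : 0 < 4 * rho + 1 by lra.
have hb : cabs (dqn n f z) <= M * (2 / (4 * rho + 1)) ^+ n.
  apply: (@max_center R (dqn n f) z (5 * rho + 1)); [exact: entire_dqn|lra|move=> s hs].
  apply: (@dqn_bound f (4 * rho + 1) (6 * rho + 1)) => //; first by lra.
    by move=> w /andP[_ w2]; apply: hM; rewrite subr0.
  have := cabsD z s; have := cabs_sub s (- z); rewrite opprK cabsN (addrC s) => h1 h2.
  by apply/andP; split; lra.
rewrite cabsM cabsX; apply: le_trans (ler_wpM2l _ hb) _; first by rewrite exprn_ge0// cabs_ge0.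
rewrite mulrCA ler_wpM2l// -exprMn.
apply: lerXn2r; rewrite ?nnegrE ?invr_ge0 ?mulr_ge0 ?cabs_ge0 ?invr_ge0 ?(ltW d0)//.
rewrite mulrA ler_pdivrMr//; lra.
Qed.

Lemma half_exp_small (M e : R) : 0 < e -> exists n, M * 2^-1 ^+ n < e.
Proof.
move=> e0; have K0 : 0 < `|M| + 1 by have := normr_ge0 M; lra.
have [n hn] := half_pow_lt (divr_gt0 e0 K0); exists n.
move: hn; rewrite ltr_pdivlMr// => hn.
have h0 : 0 < 2^-1 ^+ n :> R by rewrite exprn_gt0// invr_gt0.
have := ler_wpM2r (ltW h0) (ler_norm M); lra.
Qed.

Lemma tcoef_all0 f : entire f -> (forall n, tcoef n f = 0) -> forall z, f z = 0.
Proof.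
move=> hf h z; have [M hM] := taylor_remainder hf (cabs_ge0 z).
apply/eqP; rewrite -cabs_eq0 eq_le cabs_ge0 andbT.
apply/ler_addgt0Pr => e e0; rewrite add0r.
have [n hn] := half_exp_small M e0.
rewrite (taylor n) big1 ?add0r; last by move=> i _; rewrite h mul0r.
by apply: le_trans (hM n z (lexx _)) _; exact: ltW.
Qed.

Lemma tcoef_cst_fun f : entire f -> (forall n, tcoef n.+1 f = 0) -> forall z, f z = f 0.
Proof.
move=> hf h z; rewrite (dqE f z).
have -> : dq f z = 0.
  by apply: tcoef_all0 => [|n]; [exact: entire_dq|rewrite -tcoefS; exact: h].
by rewrite mulr0 addr0.
Qed.

(** A geometric series, with the constant term missing. *)
Lemma tcoef_bound_le f (A r rho : R) : entire f -> f 0 = 0 -> 0 <= A -> 0 <= r -> r < rho ->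
  (forall n, cabs (tcoef n.+1 f) * rho ^+ n.+1 <= A) ->
  forall z, cabs z <= r -> cabs (f z) <= A * rho / (rho - r).
Proof.
move=> hf f0 A0 r0 rr hA z hz; have rho0 : 0 < rho by lra.
have [M hM] := taylor_remainder hf (cabs_ge0 z).
apply/ler_addgt0Pr => e e0; have [n hn] := half_exp_small M e0.
rewrite (taylor n); apply: le_trans (cabsD _ _) _; apply: lerD; last first.
  by apply: le_trans (hM n z (lexx _)) _; exact: ltW.
pose x := r / rho; have x0 : 0 <= x by rewrite divr_ge0// ltW.
have x1 : x < 1 by rewrite ltr_pdivrMr// mul1r.
apply: (@le_trans _ _ (\sum_(m < n) A * x ^+ m)).
  apply: le_trans (cabs_sum _ _ _) _; apply: ler_sum => m _.
  case: m => -[|m] mn /=.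
    by rewrite /tcoef /= f0 mul0r cabs0 expr0 mulr1.
  rewrite cabsM cabsX /x expr_div_n.
  have hp : 0 < rho ^+ m.+1 by rewrite exprn_gt0.
  rewrite mulrA ler_pdivlMr// mulrAC; apply: ler_pM; rewrite ?mulr_ge0 ?exprn_ge0 ?cabs_ge0 ?(ltW rho0)//.
  by apply: lerXn2r; rewrite ?nnegrE ?cabs_ge0.
rewrite -mulr_sumr -mulrA ler_wpM2l//.
have -> : rho / (rho - r) = (1 - x)^-1.
  rewrite /x; field; rewrite subr_eq0; apply/andP; split; rewrite ?gt_eqF//; lra.
have xx : 0 < 1 - x by lra.
rewrite -[leRHS]mul1r ler_pdivlMr// mulrC.
have -> : (1 - x) * \sum_(i < n) x ^+ i = 1 - x ^+ n.
  by rewrite -[1 - x]opprB mulNr -subrX1 opprB.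
by rewrite gerBl exprn_ge0.
Qed.

End TaylorCoefficients.

(** * Logarithms and the bound on their Taylor coefficients *)

Section Logarithm.
Context {R : realType}.
Local Notation C := (Cplx R).
Implicit Types (f g h : C -> C) (z : C) (n : nat).

(** Termwise integration of the Taylor series.  The partial sums of the primitive
converge because the differences of their derivatives are small, uniformly on
discs. *)
Lemma primitive g : entire g -> exists H, forall z, is_derive z 1 H (g z).
Proof.
move=> hg.
pose u (N : nat) z : C := \sum_(m < N) (tcoef m g / m.+1%:R) * z ^+ m.+1.
have du N z : is_derive z 1 (u N) (\sum_(m < N) tcoef m g * z ^+ m).
  rewrite /u; elim: N => [|N IH].
    rewrite big_ord0 (_ : (fun _ => _) = fun=> 0); first exact: cderiv_cst.
    by apply/funext => x; rewrite big_ord0.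
  have dX : is_derive z 1 (fun x : C => x ^+ N.+1) (N.+1%:R * z ^+ N).
    elim: N {IH} => [|N IH].
      rewrite expr0 mulr1; exact: cderiv_id.
    have := cderivM (cderiv_id z) IH.
    rewrite mul1r mulrCA -exprS -[X in X + _]mul1r -mulrDl nat1r.
    by apply: cderiv_ext => x; rewrite [RHS]exprS.
  have := cderivD IH (cderivM (cderiv_cst (tcoef N g / N.+1%:R) z) dX).
  rewrite mul0r add0r mulrA mulfVK ?pnatr_eq0// big_ord_recr /=.
  by apply: cderiv_ext => x; rewrite big_ord_recr.
have rem rho : 0 <= rho -> exists2 M, 0 <= M & forall N z, cabs z <= rho -> cabs (cder (u N) z - g z) <= M * 2^-1 ^+ N.
  move=> r0; have [M hM] := taylor_remainder hg r0.
  exists (Num.max M 0) => [|N z hz]; first by rewrite le_max lexx orbT.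
  rewrite (cder_val (du N z)) cabsC (taylor N g z) addrC addKr.
  apply: le_trans (hM N z hz) _; rewrite ler_wpM2r ?exprn_ge0 ?invr_ge0//.
  by rewrite le_max lexx.
have diff rho M N K (z w : C) : (forall N z, cabs z <= rho -> cabs (cder (u N) z - g z) <= M * 2^-1 ^+ N) ->
    cabs z <= rho -> cabs w <= rho ->
    cabs ((u N z - u K z) - (u N w - u K w)) <= (M * 2^-1 ^+ N + M * 2^-1 ^+ K) * cabs (z - w).
  move=> hM hz hw; apply: (@mvt_bound R (fun z => u N z - u K z) w z) => t /andP[t0 t1].
  have dt v := cderivB (du N v) (du K v).
  split; first exact: is_derive_derivable (dt _).
  rewrite (cder_val (dt _)) -(cder_val (du N _)) -(cder_val (du K _)).
  set v := w + _; have hv : cabs v <= rho.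
    have -> : v = rc (1 - t) * w + rc t * z by rewrite /v rcB rc1; ring.
    apply: le_trans (cabsD _ _) _; rewrite !cabsM !cabs_rc !ger0_norm ?subr_ge0//.
    have : (1 - t) * cabs w <= (1 - t) * rho by rewrite ler_wpM2l ?subr_ge0.
    have : t * cabs z <= t * rho by rewrite ler_wpM2l.
    lra.
  apply: le_trans (cabs_tri (g v) _ _) _; rewrite (cabsC (g v)).
  by apply: lerD; exact: hM.
have u0 N : u N 0 = 0 by rewrite /u big1// => m _; rewrite expr0n mulr0.
have /choice[H hH] : forall z, exists w : C, forall e : R, 0 < e -> exists N0, forall N, (N0 <= N)%N -> cabs (u N z - w) <= e.
  move=> z; have [M M0 hM] := rem _ (cabs_ge0 z).
  have [|w hw] := @complete_cauchy R nat 0%N (fun N => u N z) (fun N => M * cabs z * 2^-1 ^+ N).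
    move=> i j; have := diff _ _ i j z 0 hM (lexx _).
    rewrite cabs0 !u0 !subr0 => /(_ (cabs_ge0 z)); lra.
  exists w => e e0; have [n hn] := half_exp_small (2 * (M * cabs z)) e0.
  exists n => N nN; apply: le_trans (hw N) _; apply: le_trans (ltW hn) => /=.
  rewrite [leLHS]mulrA ler_wpM2l ?mulr_ge0 ?cabs_ge0//.
  by rewrite ler_wiXn2l ?invr_ge0// invf_le1// ler1n.
exists H => z; apply/cderivP => e e0.
have [M M0 hM] := rem (cabs z + 1) (addr_ge0 (cabs_ge0 z) ler01).
have e40 : 0 < e / 4 by rewrite divr_gt0.
have [N hN] := half_exp_small M e40.
have [dl dl0 hd] := (cderivP _ _ _).1 (du N z) _ e40.
exists (Num.min dl 1); first by rewrite lt_min dl0 ltr01.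
move=> s; rewrite lt_min => /andP[s1 s2].
have {}hd := hd s s1; rewrite -(cder_val (du N z)) in hd.
have hz : cabs z <= cabs z + 1 by rewrite lerDl.
have hzs : cabs (z + s) <= cabs z + 1 by have := cabsD z s; lra.
have h2 := hM N z hz; set D := cder (u N) z in hd h2.
have hlim : cabs ((u N (z + s) - H (z + s)) - (u N z - H z)) <= e / 2 * cabs s.
  apply/ler_addgt0Pr => e1 e10; have e12 : 0 < e1 / 2 by rewrite divr_gt0.
  have [N1 h1] := hH (z + s) _ e12; have [N2 h3] := hH z _ e12.
  pose K := maxn N (maxn N1 N2).
  have {}h1 := h1 K (leq_trans (leq_maxl _ _) (leq_maxr _ _)).
  have {}h3 := h3 K (leq_trans (leq_maxr _ _) (leq_maxr _ _)).
  have hK : M * 2^-1 ^+ K <= M * 2^-1 ^+ N.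
    by rewrite ler_wpM2l// ler_wiXn2l ?invr_ge0 ?leq_maxl// invf_le1// ler1n.
  have := diff _ _ N K _ _ hM hzs hz; rewrite (addrC z s) addrK (addrC s z) => hNK.
  have -> : u N (z + s) - H (z + s) - (u N z - H z) = (u N (z + s) - u K (z + s) - (u N z - u K z)) +
    ((u K (z + s) - H (z + s)) - (u K z - H z)) by ring.
  apply: le_trans (cabsD _ _) _; apply: lerD; last first.
    by have := cabsB (u K (z + s) - H (z + s)) (u K z - H z); lra.
  apply: le_trans hNK _; rewrite ler_wpM2r ?cabs_ge0//; lra.
have -> : H (z + s) - H z - g z * s = (u N (z + s) - u N z - D * s) + (D - g z) * s
   - ((u N (z + s) - H (z + s)) - (u N z - H z)) by ring.
apply: le_trans (cabsB _ _) _; apply: le_trans (lerD (cabsD _ _) (lexx _)) _.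
have : cabs ((D - g z) * s) <= e / 4 * cabs s.
  by rewrite cabsM ler_wpM2r ?cabs_ge0// (le_trans h2)// ltW.
lra.
Qed.

Lemma tcoef_zero_fun n : tcoef n (fun=> 0 : C) = 0.
Proof. by case: n => [//|n]; exact: tcoef_cst. Qed.

Lemma cder0_cst f : (forall z, is_derive z 1 f 0) -> forall z, f z = f 0.
Proof.
move=> df; have hf : entire f by move=> z; exact: is_derive_derivable (df z).
apply: tcoef_cst_fun => // n.
have := tcoef_cder n hf; rewrite (_ : cder f = fun=> 0); last first.
  by apply/funext => z; exact: cder_val (df z).
by rewrite tcoef_zero_fun => /esym/eqP; rewrite mulf_eq0 pnatr_eq0 /= => /eqP.
Qed.

(** If h is a primitive of v' / v, then v exp (- h) has derivative zero. *)
Theorem entire_log v : entire v -> (forall z, v z != 0) ->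
  exists h, [/\ entire h, h 0 = 0 & forall z, v z = v 0 * cexp (h z)].
Proof.
move=> hv v0; have hg := entireM (entire_cder hv) (entireV v0 hv).
have [H dH] := primitive hg; pose h z := H z - H 0.
have dh z : is_derive z 1 h (cder v z / v z - 0) := cderivB (dH z) (cderiv_cst (H 0) z).
have h0 : h 0 = 0 by rewrite /h subrr.
exists h; split; [by move=> z; exact: is_derive_derivable (dh z)|exact: h0|move=> z].
have dw (x : C) : is_derive x 1 (fun x : C => v x * cexp (- h x)) 0.
  have := cderivM (cder_ex (hv x)) (cderiv_comp (cderivN (dh x)) (cderiv_cexp _)).
  have alg (V E d : C) : V != 0 -> d * E + V * (E * - (d / V - 0)) = 0 by move=> V0; field.
  by rewrite (alg _ _ _ (v0 x)).
have := cder0_cst dw z; rewrite /= h0 oppr0 cexp0 mulr1 => <-.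
by rewrite -mulrA -cexpD addNr cexp0 mulr1.
Qed.

(** The maximum principle for D^2 exp E, with E entire and
Re E = (1 + c) Re h on the circle |z| = r, where 0 <= 1 + c <= 2.  Here c = Re q with
q = al r^N / z^N, and E is h + (conj q) h / 2 + q h / 2 with the pole of q h at
the origin reflected in the circle: each term b z^(-l) is replaced by the polynomial
that has the same real part on the circle.  The choice of al makes E 0 equal to half
the modulus of the N-th Taylor term of h. *)
Lemma tcoef_log_bound (D h : C -> C) (r B : R) n : entire D -> entire h -> h 0 = 0 -> 0 < r ->
  (forall z, cabs z = r -> cabs (D z) <= B) ->
  (forall z, cabs z = r -> cabs (D z) * expR (re (h z)) <= B) ->
  cabs (D 0) ^+ 2 * expR (cabs (tcoef n.+1 h) * r ^+ n.+1 / 2) <= B ^+ 2.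
Proof.
move=> hD hh h0 r0 hB1 hB2; set N := n.+1; set a := tcoef N h.
have [al al1 ala] : exists2 al : C, cabs al = 1 & al * a = rc (cabs a).
  have [->|a0] := eqVneq a 0; first by exists 1; rewrite ?cabs1// mulr0 cabs0.
  have ca : cabs a != 0 by rewrite cabs_eq0.
  exists (cj a / rc (cabs a)); first by rewrite cabsM cabsV cabs_cj cabs_rc ger0_norm ?cabs_ge0// divff.
  by rewrite mulrAC (mulrC _ a) mulcj expr2 rcM mulfK// rc_eq0.
have rN0 : rc (r ^+ N) != 0 by rewrite rc_eq0 expf_neq0// gt_eqF.
have r20 : rc (r ^+ 2) != 0 by rewrite rc_eq0 expf_neq0// gt_eqF.
(* G is the reflected principal part of q h: conj z = r^2 / z on the circle. *)
pose G z : C := \sum_(m < N) (cj al * cj (tcoef m h) * rc ((r ^+ N)^-1 * (r ^+ 2) ^+ m)) * z ^+ (N - m).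
pose E z : C := h z + (cj al / rc (r ^+ N) * 2^-1) * (z ^+ N * h z) + (al * rc (r ^+ N) / 2) * dqn N h z
   + 2^-1 * G z.
have hE : entire E.
  apply: entireD; last first.
    apply: entireZ; apply: entire_sum => m; apply: entireZ; apply: entireX; exact: entire_id.
  apply: entireD; last by apply: entireZ; exact: entire_dqn.
  apply: (entireD hh); apply: entireZ; apply: (entireM _ hh); apply: entireX; exact: entire_id.
have E0 : re (E 0) = cabs a * r ^+ N / 2.
  rewrite /E h0 mulr0 mulr0 add0r add0r (_ : G 0 = 0); last first.
    by rewrite /G big1// => m _; rewrite expr0n subn_eq0 leqNgt ltn_ord mulr0.
  rewrite mulr0 addr0 -/(tcoef N h) -/a.
  have -> : al * rc (r ^+ N) / 2 * a = rc (cabs a * r ^+ N / 2).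
    by rewrite rc_half rcM -ala; ring.
  by rewrite re_rc.
have key z : cabs z = r -> exists2 c : R, `|c| <= 1 & re (E z) = (1 + c) * re (h z).
  move=> zr; have z0 : z != 0 by rewrite -cabs_gt0 zr.
  pose q := al * rc (r ^+ N) / z ^+ N.
  have q1 : cabs q = 1.
    rewrite /q !cabsM cabsV cabsX zr al1 mul1r cabs_rc ger0_norm ?exprn_ge0 ?ltW//.
    by rewrite divff// expf_neq0// gt_eqF.
  have cjz : cj z = rc (r ^+ 2) / z by apply: (mulfI z0); rewrite mulcj zr mulrCA divff// mulr1.
  have cjq : cj q = cj al / rc (r ^+ N) * z ^+ N.
    have qq : q * cj q = 1 by rewrite mulcj q1 expr1n.
    have q0 : q != 0 by rewrite -cabs_eq0 q1 oner_neq0.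
    apply: (mulfI q0); rewrite qq /q.
    have -> : al * rc (r ^+ N) / z ^+ N * (cj al / rc (r ^+ N) * z ^+ N) =
       (al * cj al) * (rc (r ^+ N) / rc (r ^+ N)) * (z ^+ N / z ^+ N) by ring.
    by rewrite mulcj al1 expr1n !divff// ?expf_neq0// !mulr1.
  have GE : G z = cj (q * \sum_(m < N) tcoef m h * z ^+ m).
    rewrite cjM cj_sum mulr_sumr; apply: eq_bigr => m _.
    rewrite cjM cjX cjz cjq expr_div_n -(rcX (r ^+ 2)) rcM rcV.
    have zm : z ^+ m != 0 by rewrite expf_neq0.
    have -> : z ^+ N = z ^+ (N - m) * z ^+ m by rewrite -exprD (subnK (ltnW (ltn_ord m))).
    set Z := z ^+ (N - m); set Y := z ^+ m in zm *; set A := rc (r ^+ N) in rN0 *.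
    set W := rc ((r ^+ 2) ^+ m); set X := cj al; set V := cj (tcoef m h).
    by field; apply/andP.
  exists (re q); first by rewrite -q1 re_le.
  rewrite /E GE; set Sm := \sum_(m < N) _.
  have hz : h z = Sm + z ^+ N * dqn N h z := taylor N h z.
  have -> : al * rc (r ^+ N) / 2 * dqn N h z = q * (h z - Sm) / 2.
    rewrite hz addrC addKr /q.
    have zN : z ^+ N != 0 by rewrite expf_neq0.
    set Y := z ^+ N in zN *; set A := rc (r ^+ N); set W := dqn N h z.
    by field.
  have -> : cj al / rc (r ^+ N) / 2 * (z ^+ N * h z) = cj q * h z / 2 by rewrite cjq; ring.
  have h2 : (2^-1 : C) = rc 2^-1 by rewrite rcV rc_nat.
  by rewrite h2 !reimE; field.
pose F z := D z * D z * cexp (E z).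
have hF : entire F := entireM (entireM hD hD) (entire_comp (@entire_cexp R) hE).
have : cabs (F 0) <= B ^+ 2.
  apply: (@max_center R F 0 r _ hF r0) => z zr; rewrite add0r /F !cabsM cabs_cexp.
  have [c c1 ->] := key z zr.
  have b1 := hB1 z zr; have b2 := hB2 z zr; have d0 := cabs_ge0 (D z).
  have B0 : 0 <= B by exact: le_trans b1.
  have /andP[c2 c3] : -1 <= c <= 1 by rewrite -ler_norml.
  have c4 : 0 <= 1 + c by rewrite -lerBlDl sub0r.
  have c5 : 1 + c <= 2 by lra.
  have [x0|x0] := leP 0 (re (h z)).
    apply: (@le_trans _ _ ((cabs (D z) * expR (re (h z))) ^+ 2)).
      rewrite exprMn !expr2 ler_wpM2l ?mulr_ge0// -expRD ler_expR.
      have : (1 + c) * re (h z) <= 2 * re (h z) by rewrite ler_wpM2r.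
      lra.
    by apply: lerXn2r; rewrite ?nnegrE ?mulr_ge0 ?expR_ge0.
  apply: (@le_trans _ _ (cabs (D z) ^+ 2)).
    rewrite -[leRHS]mulr1 expr2 ler_wpM2l ?mulr_ge0// -[leRHS]expR0 ler_expR.
    by rewrite mulr_ge0_le0// ltW.
  by apply: lerXn2r; rewrite ?nnegrE.
by rewrite /F !cabsM cabs_cexp E0 -expr2.
Qed.

End Logarithm.

(** * A growth lemma and a determinant lemma *)

Section Growth.
Context {R : realType}.
Implicit Types (mu : R -> R) (r s c : R).

(** Otherwise mu would more than double on each step from r to r + 1 / mu r; the n-th
step is at most 2^-n, so mu would be unbounded on a bounded interval. *)
Lemma borel_step mu (r0 : R) : 1 <= mu r0 ->
  (forall r s, r0 <= r -> r <= s -> mu r <= mu s) ->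
  exists2 r, r0 <= r & mu (r + (mu r)^-1) <= 2 * mu r.
Proof.
move=> m1 mono; apply: contrapT => nex.
have h r : r0 <= r -> 2 * mu r < mu (r + (mu r)^-1).
  by move=> hr; rewrite ltNge; apply/negP => hm; apply: nex; exists r.
pose t n := iter n (fun r => r + (mu r)^-1) r0.
have inv n : [/\ r0 <= t n, t n <= r0 + 2 - 2 * 2^-1 ^+ n & 2 ^+ n <= mu (t n)].
  elim: n => [|n [t1 t2 t3]].
    by rewrite /t /= !expr0; split=> //; lra.
  have p2 : 0 < 2 ^+ n :> R by rewrite exprn_gt0.
  have hm : (mu (t n))^-1 <= 2^-1 ^+ n by rewrite exprVn lef_pV2 ?posrE// (lt_le_trans p2).
  have hm0 : 0 <= (mu (t n))^-1 by rewrite invr_ge0 (le_trans (ltW p2)).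
  rewrite /t iterS -/(t n); split; first by rewrite (le_trans t1)// lerDl.
    by rewrite exprSr; lra.
  by rewrite exprS; have := h _ t1; lra.
have [n hn] : exists n : nat, mu (r0 + 2) < n%:R.
  by exists (Num.truncn (mu (r0 + 2))).+1; exact: truncnS_gt.
have n2 : n%:R < (2 : R) ^+ n by rewrite -natrX ltr_nat ltn_expl.
have [t1 t2 t3] := inv n.
have h2 : 0 <= 2^-1 ^+ n :> R by rewrite exprn_ge0// invr_ge0.
have : mu (t n) <= mu (r0 + 2) by apply: mono => //; lra.
by rewrite leNgt (lt_trans hn (lt_le_trans n2 t3)).
Qed.

(** With K large this is the bound of the logarithm by a small multiple of x. *)
Lemma ln_le_scaled (x K : R) : 0 < x -> 0 < K -> ln x <= x / K + ln K.
Proof.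
move=> x0 K0; have xK : 0 < x / K by rewrite divr_gt0.
have -> : ln x = ln (x / K) + ln K by rewrite -lnM ?posrE// mulfVK// gt_eqF.
rewrite lerD2r -[leRHS]expRK ler_ln ?posrE ?expR_gt0//.
by apply: le_trans (expR_ge1Dx _); rewrite lerDr.
Qed.

(** At a radius r where mu (r + 1 / mu r) is at most twice mu r, the upper bound is
O(log (mu r)), since r itself is O(mu r); so mu r stays bounded at arbitrarily
large such radii, against the linear lower bound. *)
Lemma borel_growth mu (c C1 C2 : R) : 0 < c -> 0 <= C2 ->
  (forall r s, 1 <= r -> r <= s -> mu r <= mu s) ->
  (forall r, 1 <= r -> c * r <= mu r) ->
  (forall r s, 1 <= r -> r < s -> s <= r + 1 ->
     mu r <= C1 + C2 * ln ((1 + mu s) * s / (s - r) ^+ 2)) -> False.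
Proof.
move=> c0 C20 mono low up.
(* with this K the term 4 C2 log m is at most m / 2 plus a constant *)
pose K := 8 * C2 + 8; have K0 : 0 < K by rewrite /K; lra.
pose L := ln (6 / c) + 4 * ln K; pose W := 2 * (C1 + C2 * L).
pose r0 := 1 + c^-1 + (`|W| + 1) / c.
have W0 := normr_ge0 W; have ci : 0 < c^-1 by rewrite invr_gt0.
have Wc : 0 <= (`|W| + 1) / c by rewrite divr_ge0 ?(ltW c0)//; lra.
have r01 : 1 <= r0 by rewrite /r0; lra.
have cr0 : c * r0 = c + 1 + (`|W| + 1).
  by rewrite /r0; field; rewrite gt_eqF.
have m1 : 1 <= mu r0 by apply: le_trans (low _ r01); rewrite cr0; lra.
have [r rr0 hr] := borel_step m1 (fun r s h => mono r s (le_trans r01 h)).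
have r1 : 1 <= r by exact: le_trans rr0.
have hm : mu r0 <= mu r by exact: mono.
set m := mu r in hr hm; have m0 : 1 <= m by exact: le_trans hm.
have mp : 0 < m by lra.
have mW : W < m.
  have : c * r0 <= m by apply: le_trans hm; exact: low.
  by rewrite cr0; have := ler_norm W; lra.
have mi : m^-1 <= 1 by rewrite invf_le1.
have mi0 : 0 < m^-1 by rewrite invr_gt0.
have cr : c * r <= m by exact: low.
have := up r (r + m^-1) r1.
rewrite ltrDl lerD2l => /(_ mi0 mi); rewrite -/m addrAC subrr add0r.
set X := _ / _ => hX.
have m20 : 0 <= mu (r + m^-1) by apply: le_trans (mono _ _ r1 (ltW _)); [rewrite -/m; lra|rewrite ltrDl].
have X0 : 0 < X.
  by rewrite /X divr_gt0 ?exprn_gt0// mulr_gt0; lra.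
have rc : r <= m / c by rewrite ler_pdivlMr// mulrC.
have X1 : X <= 6 / c * m ^+ 4.
  have -> : X = (1 + mu (r + m^-1)) * (r + m^-1) * m ^+ 2.
    by rewrite /X exprVn invrK.
  have -> : 6 / c * m ^+ 4 = (3 * m) * (2 * (m / c)) * m ^+ 2 by rewrite !exprS; ring.
  rewrite ler_wpM2r ?exprn_ge0 ?(ltW mp)//.
  by apply: ler_pM; lra.
have c6 : 0 < 6 / c by rewrite divr_gt0.
have lnX : ln X <= ln (6 / c) + 4 * ln m.
  apply: le_trans (_ : ln (6 / c * m ^+ 4) <= _).
    by rewrite ler_ln// posrE mulr_gt0// exprn_gt0.
  by rewrite lnM ?posrE ?exprn_gt0// lnXn// (mulr_natl (ln m) 4).
have lnm := ln_le_scaled mp K0.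
have h1 : C2 * ln X <= C2 * (L + 4 * (m / K)).
  rewrite ler_wpM2l//; apply: le_trans lnX _; rewrite /L -addrA lerD2l -mulrDr ler_wpM2l//.
  by rewrite addrC.
have h2 : C2 * (4 * (m / K)) <= m / 2.
  have -> : C2 * (4 * (m / K)) = (4 * C2 / K) * m by ring.
  have -> : m / 2 = 2^-1 * m by ring.
  rewrite ler_wpM2r ?(ltW mp)// ler_pdivrMr// /K; lra.
have : m <= C1 + C2 * L + m / 2 by rewrite mulrDr in h1; lra.
rewrite /W in mW; lra.
Qed.

End Growth.

Section Minors.

(** The finite truncations of the family reach a maximal rank, and a vector that
annihilates a truncation of maximal rank annihilates all of them. *)
Lemma indep_minor (F : fieldType) (m : nat) (phi : nat -> 'I_m -> F) :
  (forall d : 'I_m -> F, (forall n, \sum_j d j * phi n j = 0) -> forall j, d j = 0) ->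
  exists i : 'I_m -> nat, \det (\matrix_(k, j) phi (i k) j) != 0.
Proof.
move=> ind; pose M N : 'M[F]_(N, m) := \matrix_(n, j) phi n j.
have [N rN] : exists N, row_full (M N).
  pose P r := `[< exists N, \rank (M N) = r >].
  have exP : exists r, P r by exists (\rank (M 0%N)); apply/asboolP; exists 0%N.
  have ubP r : P r -> (r <= m)%N by move=> /asboolP[N <-]; exact: rank_leq_col.
  case: (ex_maxnP exP ubP) => r /asboolP[N rN] maxr.
  exists N; rewrite -col_leq_rank leqNgt; apply/negP => ltr.
  have : kermx (M N)^T != 0 by rewrite kermx_eq0 -row_leq_rank mxrank_tr -ltnNge.
  case/rowV0Pn => d /sub_kermxP dM /negP; apply; apply/eqP/rowP => j; rewrite mxE.
  apply: (ind (fun j => d 0 j)) => n.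
  have sub : (M N <= M (maxn N n.+1))%MS.
    apply/row_subP => k.
    have kN : (k < maxn N n.+1)%N by rewrite (leq_trans (ltn_ord k))// leq_maxl.
    rewrite (_ : row k (M N) = row (Ordinal kN) (M (maxn N n.+1))) ?row_sub//.
    by apply/rowP => l; rewrite !mxE.
  have eqs : (M (maxn N n.+1) <= M N)%MS.
    have := mxrank_leqif_sup sub; rewrite rN => -[_ <-].
    rewrite eqn_leq -{1}rN mxrankS//=; apply: maxr; apply/asboolP; by exists (maxn N n.+1).
  have nM : (n < maxn N n.+1)%N by rewrite leq_maxr.
  have /submxP[x hx] : (row (Ordinal nM) (M (maxn N n.+1)) <= M N)%MS.
    by apply: submx_trans eqs; exact: row_sub.
  have : d *m (row (Ordinal nM) (M (maxn N n.+1)))^T = 0.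
    by rewrite hx trmx_mul mulmxA dM mul0mx.
  move/matrixP => /(_ 0 0); rewrite !mxE => h; rewrite -[RHS]h.
  by apply: eq_bigr => l _; rewrite !mxE.
exists (fun k => fullrankfun rN k).
have := fullrowsub_unit rN; rewrite unitmxE unitfE.
by congr (\det _ != 0); apply/matrixP => k j; rewrite !mxE.
Qed.

End Minors.

(** * Iterated derivatives *)

Section IteratedDerivative.
Context {R : realType}.
Local Notation C := (Cplx R).
Implicit Types (f g h : C -> C) (z : C) (n : nat).

Definition cdern n f : C -> C := iter n cder f.

Lemma cdernS n f : cdern n.+1 f = cdern n (cder f). Proof. exact: iterSr. Qed.

Lemma entire_cdern n f : entire f -> entire (cdern n f).
Proof. by move=> hf; elim: n => [|n IH]; [exact: hf|exact: entire_cder IH]. Qed.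

Lemma cdern_coef n f : entire f -> cdern n f 0 = (n`!)%:R * tcoef n f.
Proof.
elim: n f => [|n IH] f hf; first by rewrite mul1r.
by rewrite cdernS (IH _ (entire_cder hf)) (tcoef_cder n hf) mulrA -natrM mulnC.
Qed.

Lemma cdern_shift n f (a : C) : entire f ->
  cdern n (fun s => f (a + s)) = fun s => cdern n f (a + s).
Proof.
elim: n f => [//|n IH] f hf; rewrite !cdernS.
have -> : cder (fun s => f (a + s)) = fun s => cder f (a + s).
  by apply/funext => s; exact: cder_shift.
exact: IH _ (entire_cder hf).
Qed.

Lemma tcoef_sum m n (c : 'I_m -> C) (u : 'I_m -> C -> C) : (forall j, entire (u j)) ->
  tcoef n (fun z => \sum_j c j * u j z) = \sum_j c j * tcoef n (u j).
Proof.
move=> hu; elim: (index_enum _) => [|j r IH].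
  rewrite big_nil (_ : (fun z => _) = fun=> 0); first exact: tcoef_zero_fun.
  by apply/funext => z; rewrite big_nil.
have h1 : entire (fun x => \sum_(j <- r) c j * u j x).
  by apply: entire_sum => i; exact: entireZ.
rewrite big_cons -IH -tcoefZ; last exact: hu.
rewrite -(tcoefD n (@entireZ R (c j) _ (hu j)) h1).
have -> : (fun z => \sum_(i <- j :: r) c i * u i z) = fun z => c j * u j z + \sum_(i <- r) c i * u i z.
  by apply/funext => z; rewrite big_cons.
by [].
Qed.

Lemma cder_sum m (c : 'I_m -> C) (u : 'I_m -> C -> C) : (forall j, entire (u j)) ->
  cder (fun z => \sum_j c j * u j z) = fun z => \sum_j c j * cder (u j) z.
Proof.
move=> hu; apply/funext => z; elim: (index_enum _) => [|j r IH].
  rewrite big_nil (_ : (fun z => _) = fun=> 0); first exact: cder_val (cderiv_cst 0 z).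
  by apply/funext => x; rewrite big_nil.
rewrite big_cons -IH -cderZ; last exact: hu.
have h1 : entire (fun x => \sum_(j <- r) c j * u j x).
  by apply: entire_sum => i; exact: entireZ.
rewrite -(cder_val (cderivD (cder_ex (@entireZ R (c j) _ (hu j) z)) (cder_ex (h1 z)))).
have -> : (fun z => \sum_(i <- j :: r) c i * u i z) = fun z => c j * u j z + \sum_(i <- r) c i * u i z.
  by apply/funext => x; rewrite big_cons.
by [].
Qed.

Lemma cdern_sum m n (c : 'I_m -> C) (u : 'I_m -> C -> C) : (forall j, entire (u j)) ->
  cdern n (fun z => \sum_j c j * u j z) = fun z => \sum_j c j * cdern n (u j) z.
Proof.
elim: n u => [//|n IH] u hu; rewrite cdernS (cder_sum c hu) IH; last first.
  by move=> j; exact: entire_cder.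
by apply/funext => z; apply: eq_bigr => j _; rewrite cdernS.
Qed.

Lemma cdern_one n z : cdern n (fun=> 1 : C) z = (n == 0)%:R.
Proof.
case: n => [//|n]; rewrite cdernS (_ : cder _ = fun=> 0); last first.
  by apply/funext => x; exact: cder_val (cderiv_cst 1 x).
elim: n => [//|n IH]; rewrite cdernS (_ : cder _ = fun=> 0)//.
by apply/funext => x; exact: cder_val (cderiv_cst 0 x).
Qed.

Lemma cdern_bound n f z (d M : R) : entire f -> 0 < d ->
  (forall s, cabs s = d -> cabs (f (z + s)) <= M) ->
  cabs (cdern n f z) <= (n`!)%:R * (M * (2 / d) ^+ n).
Proof.
move=> hf d0 hM; rewrite -[z]addr0.
have <- : cdern n (fun s => f (z + s)) 0 = cdern n f (z + 0) by rewrite cdern_shift.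
rewrite cdern_coef; last exact: entire_shift.
rewrite cabsM cabs_nat ler_wpM2l//.
by apply: (@tcoef_le R _ d M n (@entire_shift R f z hf) d0 hM).
Qed.

Lemma det_bound p (A : 'M[C]_p) (La : R) : 0 <= La -> (forall i j, cabs (A i j) <= La) ->
  cabs (\det A) <= (p`!)%:R * La ^+ p.
Proof.
move=> La0 hA; apply: le_trans (cabs_sum _ _ _) _.
apply: (@le_trans _ _ (\sum_(s : 'S_p) La ^+ p)); last first.
  by rewrite sumr_const card_Sn mulr_natl.
apply: ler_sum => s _; rewrite cabsM cabsX cabsN cabs1 expr1n mul1r cabs_prod.
rewrite -[X in _ <= La ^+ X]card_ord -prodr_const.
by apply: ler_prod => i _; rewrite cabs_ge0 hA.
Qed.

End IteratedDerivative.

(** * Linearly independent functions without zeros *)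

Section Units.
Context {R : realType}.
Local Notation C := (Cplx R).

(** The Taylor coefficients bound h on a disc of radius between r and s, the
Cauchy estimate bounds its derivative, and the bound on t is what makes the
increment at most 1. *)
Lemma log_osc (h : C -> C) (r s A : R) (z t : C) : entire h -> h 0 = 0 -> 0 <= A ->
  1 <= r -> r < s -> s <= r + 1 ->
  (forall n, cabs (tcoef n.+1 h) * s ^+ n.+1 <= A) ->
  cabs z = r -> cabs t <= (s - r) ^+ 2 / (16 * ((1 + A) * s)) ->
  cabs (h (z + t) - h z) <= 1.
Proof.
move=> hh h0 A0 r1 rs sr hA zr ht.
set d := s - r in ht *; have d0 : 0 < d by rewrite /d; lra.
have d1 : d <= 1 by rewrite /d; lra.
have s1 : 1 <= s by lra.
have As0 : 0 < (1 + A) * s by rewrite mulr_gt0//; lra.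
have As1 : 1 <= (1 + A) * s.
  by rewrite -[leLHS]mulr1; apply: ler_pM => //; lra.
have dd : d ^+ 2 / (16 * ((1 + A) * s)) <= d / 4.
  rewrite ler_pdivrMr; last by rewrite mulr_gt0.
  have : d ^+ 2 <= d * 1 by rewrite expr2 ler_wpM2l// ltW.
  have : d * 1 <= d * ((1 + A) * s) by rewrite ler_wpM2l// ltW.
  lra.
have hb w : cabs w <= r + d / 2 -> cabs (h w) <= 2 * A * s / d.
  move=> hw; have := @tcoef_bound_le R h A (r + d / 2) s hh h0 A0.
  have -> : s - (r + d / 2) = d / 2 by rewrite /d; field.
  have -> : A * s / (d / 2) = 2 * A * s / d by field; rewrite gt_eqF.
  by apply=> //; rewrite /d in d0 *; lra.
have hd w : cabs w <= r + d / 4 -> cabs (cder h w) <= 16 * A * s / d ^+ 2.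
  move=> hw; have := @cauchy_est R h w (d / 4) (2 * A * s / d) hh.
  have -> : 2 * (2 * A * s / d) / (d / 4) = 16 * A * s / d ^+ 2 by field; rewrite gt_eqF.
  apply; first by rewrite divr_gt0.
  by move=> q hq; apply: hb; have := cabsD w q; lra.
have := @mvt_bound R h z (z + t) (16 * A * s / d ^+ 2).
rewrite (addrC z) addrK => hm; apply: le_trans (hm _) _.
  move=> x hx; split; first exact: hh.
  by apply: hd; have := cabsD z (rc x * t); have := cabs_seg t hx; lra.
have K0 : 0 <= 16 * A * s / d ^+ 2.
  by rewrite divr_ge0 ?exprn_ge0 ?mulr_ge0//; lra.
apply: le_trans (ler_wpM2l K0 ht) _.
have -> : 16 * A * s / d ^+ 2 * (d ^+ 2 / (16 * ((1 + A) * s))) = A / (1 + A).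
  by field; apply/and3P; split; rewrite gt_eqF//; lra.
by rewrite ler_pdivrMr; lra.
Qed.

(** The derivatives of order i_k of the relation form a linear system for the c_j u_j,
with the logarithmic quotients as matrix and a determinant that is not
identically zero by independence.  Cramer's rule bounds the products of this
determinant with the u_j on circles by powers of these quotients, hence the Taylor
coefficients of log u_j by logarithms of the growth of the log u_j themselves. *)
Theorem indep_units m (u : 'I_m -> C -> C) (c : 'I_m -> C) :
  (forall j, entire (u j)) -> (forall j z, u j z != 0) -> (forall j, c j != 0) ->
  (forall z, \sum_j c j * u j z = 1) ->
  (forall d : 'I_m -> C, (forall z, \sum_j d j * u j z = 0) -> forall j, d j = 0) ->
  forall j z, u j z = u j 0.
Proof.
move=> hu u0 c0 rel ind.
have /choice[h hh] : forall j, exists h, [/\ entire h, h 0 = 0 & forall z, u j z = u j 0 * cexp (h z)].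
  by move=> j; apply: entire_log.
have hE j : entire (h j) by case: (hh j).
have h00 j : h j 0 = 0 by case: (hh j).
have uE j z : u j z = u j 0 * cexp (h j z) by case: (hh j).
(* The orders i k need not be consecutive: they are chosen so that the determinant
   is nonzero at 0, which avoids any theorem on Wronskians. *)
have [i hi] : exists i : 'I_m -> nat, \det (\matrix_(k, j) cdern (i k) (u j) 0) != 0.
  apply: (@indep_minor _ m (fun n j => cdern n (u j) 0)) => d hd; apply: ind => z.
  apply: (@tcoef_all0 R (fun z => \sum_j d j * u j z)).
    by apply: entire_sum => j; exact: (@entireZ R (d j) _ (hu j)).
  move=> n; rewrite (tcoef_sum n d hu).
  have := hd n; under eq_bigr do rewrite cdern_coef// mulrCA.
  rewrite -mulr_sumr => /eqP; rewrite mulf_eq0 pnatr_eq0.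
  by rewrite eqn0Ngt fact_gt0 /= => /eqP.
pose L z : 'M[C]_m := \matrix_(k, j) (cdern (i k) (u j) z / u j z).
pose De z := \det (L z).
have hDe : entire De.
  apply: entire_det => k j.
  rewrite (_ : (fun x => L x k j) = fun x => cdern (i k) (u j) x * (u j x)^-1); last first.
    by apply/funext => x; rewrite mxE.
  by apply: entireM; [exact: entire_cdern|apply: entireV].
have De0 : De 0 != 0.
  have LE : L 0 = (\matrix_(k, j) cdern (i k) (u j) 0) *m diag_mx (\row_j (u j 0)^-1).
    by apply/matrixP => k j; rewrite mul_mx_diag !mxE.
  rewrite /De LE det_mulmx det_diag mulf_neq0//.
  by apply/prodf_neq0 => j _; rewrite mxE invr_eq0.
have cramer z j : De z * (c j * u j z) = \sum_k (\adj (L z)) j k * (i k == 0%N)%:R.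
  pose v : 'cV[C]_m := \col_j (c j * u j z).
  have Lv : L z *m v = \col_k (i k == 0%N)%:R.
    apply/matrixP => k q; rewrite !mxE.
    have := congr1 (fun f => cdern (i k) f z) (funext rel : (fun z => \sum_j c j * u j z) = fun=> 1).
    rewrite /= (cdern_sum (i k) c hu) cdern_one => <-.
    by apply: eq_bigr => l _; rewrite !mxE mulrCA divfK.
  have : \adj (L z) *m (L z *m v) = De z *: v.
    by rewrite mulmxA mul_adj_mx mul_scalar_mx.
  rewrite Lv => /matrixP/(_ j 0); rewrite !mxE => <-.
  by apply: eq_bigr => k _; rewrite !mxE.
(* mu is the maximal Taylor term of the h j; adjoining 0 makes the set nonempty
   and mu nonnegative. *)
pose T r : set R := [set x | x = 0 \/ exists j n, x = cabs (tcoef n.+1 (h j)) * r ^+ n.+1].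
pose mu r := sup (T r).
have T0 r : T r 0 by left.
have bT r : 0 < r -> has_sup (T r).
  move=> r0; split; first by exists 0.
  have /choice[M hM] : forall j, exists M, forall z, cabs (z - 0) <= 2 * r -> cabs (h j z) <= M.
    by move=> j; exact: (entire_bounded 0 (2 * r) (hE j)).
  have M0 j : 0 <= M j.
    have hM0 : cabs (h j 0) <= M j by apply: hM; rewrite subrr cabs0; lra.
    exact: le_trans (cabs_ge0 _) hM0.
  exists (\sum_j M j) => x [->|[j [n ->]]]; first by apply: sumr_ge0.
  apply: (@le_trans _ _ (M j)); last by rewrite (bigD1 j)//= lerDl sumr_ge0.
  have hc : cabs (tcoef n.+1 (h j)) <= M j * (2 / (2 * r)) ^+ n.+1.
    apply: (@tcoef_le R (h j) (2 * r) (M j) n.+1 (hE j)); first by rewrite mulr_gt0.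
    by move=> z hz; apply: hM; rewrite subr0 hz.
  have -> : M j = M j * (2 / (2 * r)) ^+ n.+1 * r ^+ n.+1.
    rewrite -mulrA -exprMn (_ : 2 / (2 * r) * r = 1) ?expr1n ?mulr1//.
    by field; rewrite gt_eqF.
  by rewrite ler_wpM2r// exprn_ge0// ltW.
have muT r x : 0 < r -> T r x -> x <= mu r.
  by move=> r0 Tx; apply: ub_le_sup => //; exact: (bT r r0).2.
have mu_le r B : 0 < r -> 0 <= B -> (forall j n, cabs (tcoef n.+1 (h j)) * r ^+ n.+1 <= B) -> mu r <= B.
  move=> r0 B0 hB; apply: ge_sup; first by exists 0.
  by move=> x [->//|[j [n ->]]].
suff a0 j n : tcoef n.+1 (h j) = 0.
  move=> j z; rewrite [LHS]uE.
  by rewrite (tcoef_cst_fun (hE j) (a0 j) z) h00 cexp0 mulr1.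
apply/eqP; apply: contrapT => /negP a0.
have mono r s : 1 <= r -> r <= s -> mu r <= mu s.
  move=> r1 rs; have s0 : 0 < s by lra.
  apply: mu_le => [||k l]; [by lra|exact: muT|].
  apply: (@le_trans _ _ (cabs (tcoef l.+1 (h k)) * s ^+ l.+1)).
    by rewrite ler_wpM2l ?cabs_ge0// lerXn2r// nnegrE; lra.
  by apply: muT => //; right; exists k, l.
(* Constants of the upper bound: on the circle the quotients are at most
   E0 (32 X)^J, and D and the D exp (h j) are at most K1 X^P, where
   X = (1 + mu s) s / (s - r)^2. *)
pose J := \max_k i k.
pose E0 : R := (J`!)%:R * expR 1.
pose K0 : R := (m`!)%:R * (1 + \sum_j m%:R / (cabs (c j) * cabs (u j 0))).
pose K1 := K0 * (E0 * 32 ^+ J) ^+ m.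
pose P := (J * m)%N.
have E01 : 1 <= E0.
  rewrite /E0 -[leLHS]mulr1; apply: ler_pM => //; first by rewrite ler1n fact_gt0.
  by have := @expR_ge1Dx R 1; lra.
have sum0 : 0 <= \sum_j m%:R / (cabs (c j) * cabs (u j 0)).
  by apply: sumr_ge0 => k _; rewrite divr_ge0// mulr_ge0// cabs_ge0.
have K00 : 0 < K0 by rewrite /K0 mulr_gt0 ?ltr0n ?fact_gt0//; lra.
have K10 : 0 < K1 by rewrite /K1 mulr_gt0// exprn_gt0// mulr_gt0 ?exprn_gt0//; lra.
have Dn0 : 0 < cabs (De 0) by rewrite cabs_gt0.
apply: (@borel_growth R mu (cabs (tcoef n.+1 (h j))) (2 * ln (K1 ^+ 2 / cabs (De 0) ^+ 2)) (4 * P%:R)).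
- by rewrite cabs_gt0.
- by rewrite mulr_ge0.
- exact: mono.
- move=> r r1; apply: (@le_trans _ _ (cabs (tcoef n.+1 (h j)) * r ^+ n.+1)).
    rewrite ler_wpM2l ?cabs_ge0// exprS -[leLHS]mulr1 ler_wpM2l ?exprn_ege1//; lra.
  by apply: muT; [lra|right; exists j, n].
move=> r s r1 rs sr; set X := (1 + mu s) * s / (s - r) ^+ 2.
have r0 : 0 < r by lra.
have s0 : 0 < s by lra.
pose A := mu s; have A0 : 0 <= A by exact: muT.
have d0 : 0 < s - r by lra.
have X1 : 1 <= X.
  rewrite /X ler_pdivlMr ?exprn_gt0// mul1r.
  have sr1 : s - r <= 1 by lra.
  apply: (@le_trans _ _ 1); first by rewrite expr2 -[leRHS]mulr1; apply: ler_pM => //; exact: ltW.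
  by rewrite -[leLHS]mulr1; apply: ler_pM => //; rewrite -/A; lra.
have X0 : 0 < X by lra.
pose de := (s - r) ^+ 2 / (16 * ((1 + A) * s)).
have de0 : 0 < de by rewrite /de divr_gt0 ?exprn_gt0// !mulr_gt0//; lra.
have deX : 2 / de = 32 * X.
  by rewrite /de /X -/A; field; apply/and3P; split; rewrite gt_eqF//; lra.
pose La := E0 * (32 * X) ^+ J.
have X32 : 1 <= 32 * X by lra.
have La0 : 0 <= La by apply: mulr_ge0; [lra|apply: exprn_ge0; lra].
have La1 : 1 <= La.
  by rewrite /La -[leLHS]mulr1; apply: ler_pM => //; rewrite exprn_ege1.
have hL z k l : cabs z = r -> cabs (L z k l) <= La.
  move=> zr; rewrite mxE cabsM cabsV.
  have uz : 0 < cabs (u l z) by rewrite cabs_gt0.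
  rewrite ler_pdivrMr//.
  have hb : forall t, cabs t = de -> cabs (u l (z + t)) <= expR 1 * cabs (u l z).
    move=> t td; rewrite (uE l (z + t)) (uE l z) !cabsM !cabs_cexp.
    rewrite mulrCA ler_wpM2l ?cabs_ge0// -expRD ler_expR -lerBlDr -reB.
    apply: le_trans (ler_norm _) _; apply: le_trans (re_le _) _.
    apply: (@log_osc (h l) r s A z t (hE l) (h00 l) A0 r1 rs sr _ zr); last by rewrite td.
    by move=> q; apply: muT; [exact: s0|right; exists l, q].
  apply: le_trans (cdern_bound (i k) (hu l) de0 hb) _.
  have iJ : (i k <= J)%N by exact: leq_bigmax.
  rewrite deX /La /E0.
  have -> : (J`!)%:R * expR 1 * (32 * X) ^+ J * cabs (u l z) = (J`!)%:R * (expR 1 * cabs (u l z) * (32 * X) ^+ J) by ring.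
  apply: ler_pM => //; first by rewrite !mulr_ge0 ?expR_ge0 ?cabs_ge0 ?exprn_ge0//; lra.
    by rewrite ler_nat leq_fact.
  by rewrite ler_wpM2l ?mulr_ge0 ?expR_ge0 ?cabs_ge0// ler_weXn2l.
pose B := K0 * La ^+ m.
have BE : B = K1 * X ^+ P.
  by rewrite /B /K1 /La /P exprM !exprMn; ring.
have Lam0 : 0 <= La ^+ m by rewrite exprn_ge0.
have hB1 z : cabs z = r -> cabs (De z) <= B.
  move=> zr; apply: le_trans (det_bound La0 (fun k l => hL z k l zr)) _.
  by rewrite /B /K0 ler_wpM2r// -[leLHS]mulr1 ler_wpM2l//; lra.
have hB2 l z : cabs z = r -> cabs (De z) * expR (re (h l z)) <= B.
  move=> zr; have cu : 0 < cabs (c l) * cabs (u l 0) by rewrite mulr_gt0 ?cabs_gt0.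
  have : cabs (De z * (c l * u l z)) <= m%:R * ((m`!)%:R * La ^+ m).
    rewrite cramer; apply: le_trans (cabs_sum _ _ _) _.
    apply: (@le_trans _ _ (\sum_(k < m) ((m`!)%:R * La ^+ m))); last first.
      by rewrite sumr_const card_ord [leRHS]mulr_natl.
    apply: ler_sum => k _; rewrite cabsM mxE.
    apply: (@le_trans _ _ (cabs (cofactor (L z) k l) * 1)).
      have b1 (b : bool) : cabs (b%:R : C) <= 1 by case: b; rewrite ?cabs1 ?cabs0.
      by rewrite ler_wpM2l ?cabs_ge0.
    rewrite mulr1 cabsM cabsX cabsN cabs1 expr1n mul1r.
    apply: le_trans (det_bound La0 _) _.
      by move=> p q; rewrite mxE mxE; exact: hL.
    apply: ler_pM; rewrite ?exprn_ge0// ?ler_nat ?leq_fact ?leq_pred//.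
    by rewrite ler_weXn2l// leq_pred.
  rewrite !cabsM (uE l z) cabsM cabs_cexp => hm.
  rewrite -(ler_pM2r cu); apply: le_trans (le_trans _ hm) _; first by rewrite le_eqVlt; apply/orP; left; apply/eqP; ring.
  have : m%:R <= (1 + \sum_j m%:R / (cabs (c j) * cabs (u j 0))) * (cabs (c l) * cabs (u l 0)).
    rewrite -ler_pdivrMr// (bigD1 l)//=.
    have : 0 <= \sum_(j < m | j != l) m%:R / (cabs (c j) * cabs (u j 0)).
      by apply: sumr_ge0 => k _; rewrite divr_ge0// mulr_ge0// cabs_ge0.
    lra.
  have FL : 0 <= (m`!)%:R * La ^+ m by rewrite mulr_ge0.
  move=> /(ler_wpM2r FL); rewrite /B /K0; lra.
have B0 : 0 < B by rewrite BE mulr_gt0// exprn_gt0.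
have key k l : cabs (tcoef l.+1 (h k)) * r ^+ l.+1 <= 2 * ln (K1 ^+ 2 / cabs (De 0) ^+ 2) + 4 * P%:R * ln X.
  have := tcoef_log_bound l hDe (hE k) (h00 k) r0 hB1 (hB2 k).
  set Y := cabs (tcoef _ _) * _.
  rewrite -ler_pdivlMl ?exprn_gt0// => hY.
  have : Y / 2 <= ln ((cabs (De 0) ^+ 2)^-1 * B ^+ 2).
    rewrite -[leLHS]expRK ler_ln// ?posrE ?expR_gt0//.
    by rewrite mulr_gt0 ?invr_gt0 ?exprn_gt0.
  have -> : (cabs (De 0) ^+ 2)^-1 * B ^+ 2 = K1 ^+ 2 / cabs (De 0) ^+ 2 * X ^+ (P * 2).
    by rewrite BE exprMn -exprM; ring.
  rewrite lnM ?posrE ?divr_gt0 ?exprn_gt0// lnXn// -(mulr_natl (ln X)) natrM; lra.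
apply: mu_le => //.
by apply: le_trans (key j n); rewrite mulr_ge0 ?cabs_ge0 ?exprn_ge0 ?(ltW r0).
Qed.

End Units.

(** * Borel's theorem and families of monic polynomials *)

Section BorelTheorem.
Context {R : realType}.
Local Notation C := (Cplx R).

(** A relation of minimal length has nonzero coefficients and linearly independent
terms; a vanishing coefficient or a linear dependence shortens it. *)
Theorem borel m (u : 'I_m -> C -> C) (c : 'I_m -> C) :
  (forall j, entire (u j)) -> (forall j z, u j z != 0) ->
  (forall z, \sum_j c j * u j z = 1) -> exists j, forall z, u j z = u j 0.
Proof.
elim: m u c => [|m IH] u c hu u0 rel.
  by have /eqP := rel 0; rewrite big_ord0 eq_sym oner_eq0.
have drop (b : 'I_m.+1 -> C) j0 : b j0 = 0 -> (forall z, \sum_j b j * u j z = 1) ->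
    exists j, forall z, u j z = u j 0.
  move=> b0 hb; have [j hj] : exists j, forall z, u (lift j0 j) z = u (lift j0 j) 0.
    apply: (IH (fun j => u (lift j0 j)) (fun j => b (lift j0 j))).
    - by move=> j; exact: hu.
    - by move=> j z; exact: u0.
    - by move=> z; rewrite -(hb z) (bigD1_ord j0)//= b0 mul0r add0r.
  by exists (lift j0 j).
have [[j0 cj0]|c0] := pselect (exists j, c j = 0); first exact: drop cj0 rel.
have [[d [j0 [hd dj0]]]|ind] := pselect (exists d : 'I_m.+1 -> C, exists j0,
    (forall z, \sum_j d j * u j z = 0) /\ d j0 != 0).
  apply: (drop (fun j => c j - c j0 / d j0 * d j) j0); first by rewrite divfK// subrr.
  move=> z; set k := c j0 / d j0.
  have -> : \sum_j (c j - k * d j) * u j z = \sum_j c j * u j z - k * \sum_j d j * u j z.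
    rewrite [k * _]mulr_sumr -sumrB; apply: eq_bigr => j _; ring.
  by rewrite rel hd mulr0 subr0.
exists ord0 => z; apply: (indep_units hu u0 _ rel) => [j|d hd j].
  by apply/eqP => cj0; apply: c0; exists j.
by apply/eqP; apply: contrapT => /negP dj; apply: ind; exists d, j.
Qed.

End BorelTheorem.

Section PolynomialFamilies.

(** The coefficients of Lagrange interpolation in top degree, obtained by inverting
the Vandermonde matrix. *)
Lemma lead_coef_from_values (F : fieldType) n (b : 'I_n.+1 -> F) : injective b ->
  exists c : 'I_n.+1 -> F, forall p : {poly F}, (size p <= n.+1)%N ->
    \sum_j c j * p.[b j] = p`_n.
Proof.
move=> binj; pose V := Vandermonde n.+1 (\row_j b j).
have Vu : V \in unitmx.
  rewrite unitmxE det_Vandermonde unitfE.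
  apply/prodf_neq0 => i _; apply/prodf_neq0 => j ij.
  by rewrite !mxE subr_eq0 (inj_eq binj) neq_ltn ij orbT.
pose cv : 'cV[F]_n.+1 := invmx V *m delta_mx ord_max 0.
exists (fun j => cv j 0) => p sp.
have hV (i : 'I_n.+1) : \sum_j b j ^+ i * cv j 0 = (i == ord_max)%:R.
  have := mulKVmx Vu (delta_mx ord_max (0 : 'I_1) : 'cV[F]_n.+1).
  move/matrixP/(_ i 0); rewrite !mxE andbT => <-.
  by apply: eq_bigr => j _; rewrite !mxE.
have h (i : 'I_n.+1) : \sum_j cv j 0 * (p`_i * b j ^+ i) = p`_i * (i == ord_max)%:R.
  by rewrite -hV mulr_sumr; apply: eq_bigr => j _; ring.
under eq_bigr do rewrite (horner_coef_wide _ sp) mulr_sumr.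
rewrite exchange_big /= (eq_bigr _ (fun i _ => h i)) (bigD1 ord_max)//= eqxx mulr1.
by rewrite big1 ?addr0// => i /negPf ->; rewrite mulr0.
Qed.

(** Among n + 1 values, Borel's theorem and the interpolation of the leading
coefficient, which is 1, provide a constant one; so fewer than n + 1 values vary, and the
remaining ones, at least n, determine a monic polynomial of degree n.  The number
2 n of points is exactly what this count needs. *)
Theorem monic_family_constant (R : realType) n (P : Cplx R -> {poly Cplx R}) (a : 'I_(2 * n) -> Cplx R) :
  injective a -> (forall z, P z \is monic) -> (forall z, size (P z) = n.+1) ->
  (forall k, entire (fun z => (P z).[a k])) -> (forall k z, (P z).[a k] != 0) ->
  forall z, P z = P 0.
Proof.
move=> ainj Pm sP hP P0 z.
pose S : {set 'I_(2 * n)} := finset (fun k => `[< forall z, (P z).[a k] = (P 0).[a k] >]).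
have [nS|nS] := leqP n #|S|.
  pose rs := [seq a k | k <- enum S].
  apply/eqP; rewrite -subr_eq0; apply/eqP; apply: (@roots_geq_poly_eq0 _ _ rs).
  - apply/allP => x /mapP[k + ->]; rewrite mem_enum inE => /asboolP hk.
    by rewrite rootE hornerD hornerN hk subrr.
  - by rewrite map_inj_uniq ?enum_uniq.
  rewrite size_map -cardE; apply: leq_trans nS; apply/leq_sizeP => j.
  rewrite leq_eqVlt => /orP[/eqP <-|nj].
    have /monicP := Pm z; have /monicP := Pm 0; rewrite !lead_coefE !sP /= => h1 h2.
    by rewrite coefB h1 h2 subrr.
  by rewrite coefB !nth_default ?sP ?subrr.
have cS : (n < #|(~: S)%SET|)%N.
  have := cardsC S; rewrite card_ord; move: nS; lia.
pose f (j : 'I_n.+1) : 'I_(2 * n) := enum_val (widen_ord cS j).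
have finj : injective f.
  by move=> i j /enum_val_inj/(congr1 val)/= h; apply: val_inj.
have fS j : f j \notin S by have := enum_valP (widen_ord cS j); rewrite inE.
have [c hc] := lead_coef_from_values (inj_comp ainj finj).
have [|j|z1|j hj] := @borel R n.+1 (fun j z => (P z).[a (f j)]) c.
- by move=> j; exact: hP.
- by move=> z1; exact: P0.
- rewrite (hc (P z1)) ?sP//.
  by have /monicP := Pm z1; rewrite lead_coefE sP.
by have := fS j; rewrite inE => /asboolP; case.
Qed.

End PolynomialFamilies.

(** * Holomorphy of the coefficients of the characteristic polynomial *)

Section MatrixDifferentiability.
Context {R : realType}.
Local Notation C := (Cplx R).
Variables (V : normedModType C) (x : V).

Lemma mx_differentiable m n (f : V -> 'M[C]_(m, n)) :
  (forall i j, differentiable (fun y => f y i j : C) x) -> differentiable f x.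
Proof.
move=> hf.
have -> : f = \sum_(i < m) \sum_(j < n) (fun y => f y i j *: delta_mx i j).
  apply/funext => y; rewrite [LHS]matrix_sum_delta fct_sumE.
  by apply: eq_bigr => i _; rewrite fct_sumE.
apply: differentiable_sum => i; apply: differentiable_sum => j.
exact: differentiableZl (hf i j).
Qed.

Lemma differentiableMf (f g : V -> C) : differentiable f x -> differentiable g x ->
  differentiable (fun y => f y * g y) x.
Proof. by move=> hf hg; exact: differentiableM hf hg. Qed.

(** Differentiability of a polynomial coefficient by coefficient; it is stable
under sums and products, hence under determinants, without a topology on
polynomials. *)
Definition pdiff (p : V -> {poly C}) := forall k, differentiable (fun y => (p y)`_k : C) x.

Lemma differentiable_sumf I (r : seq I) (F : I -> V -> C) :
  (forall i, differentiable (F i) x) -> differentiable (fun y => \sum_(i <- r) F i y) x.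
Proof.
move=> hF; elim: r => [|i r IH].
  rewrite (_ : (fun y => _) = cst 0); first exact: differentiable_cst.
  by apply/funext => y; rewrite big_nil.
rewrite (_ : (fun y => _) = F i + (fun y => \sum_(i <- r) F i y)).
  by apply: differentiableD; [exact: hF|exact: IH].
by apply/funext => y; rewrite big_cons.
Qed.

Lemma pdiff_cst p : pdiff (fun=> p).
Proof. by move=> k; exact: differentiable_cst. Qed.
Lemma pdiffD p q : pdiff p -> pdiff q -> pdiff (fun y => p y + q y).
Proof.
move=> hp hq k.
rewrite (_ : (fun y => _) = (fun y => (p y)`_k : C) + (fun y => (q y)`_k : C)).
  by apply: differentiableD; [exact: hp|exact: hq].
by apply/funext => y; rewrite coefD.
Qed.
Lemma pdiffM p q : pdiff p -> pdiff q -> pdiff (fun y => p y * q y).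
Proof.
move=> hp hq k.
rewrite (_ : (fun y => _) = fun y => \sum_(j < k.+1) (p y)`_j * (q y)`_(k - j)); last first.
  by apply/funext => y; rewrite coefM.
apply: differentiable_sumf => j.
exact: differentiableMf (hp j) (hq (k - j)%N).
Qed.
Lemma pdiff_sum I (r : seq I) (F : I -> V -> {poly C}) :
  (forall i, pdiff (F i)) -> pdiff (fun y => \sum_(i <- r) F i y).
Proof.
move=> hF; elim: r => [|i r IH].
  rewrite (_ : (fun y => _) = fun=> 0); first exact: pdiff_cst.
  by apply/funext => y; rewrite big_nil.
rewrite (_ : (fun y => _) = fun y => F i y + \sum_(i <- r) F i y).
  by apply: pdiffD; [exact: hF|exact: IH].
by apply/funext => y; rewrite big_cons.
Qed.
Lemma pdiff_prod I (r : seq I) (F : I -> V -> {poly C}) :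
  (forall i, pdiff (F i)) -> pdiff (fun y => \prod_(i <- r) F i y).
Proof.
move=> hF; elim: r => [|i r IH].
  rewrite (_ : (fun y => _) = fun=> 1); first exact: pdiff_cst.
  by apply/funext => y; rewrite big_nil.
rewrite (_ : (fun y => _) = fun y => F i y * \prod_(i <- r) F i y).
  by apply: pdiffM; [exact: hF|exact: IH].
by apply/funext => y; rewrite big_cons.
Qed.
Lemma pdiff_polyC (f : V -> C) : differentiable f x -> pdiff (fun y => (f y)%:P).
Proof.
move=> hf [|k].
  by rewrite (_ : (fun y => _) = f)//; apply/funext => y; rewrite coefC.
rewrite (_ : (fun y => _) = cst 0); first exact: differentiable_cst.
by apply/funext => y; rewrite coefC.
Qed.

Lemma pdiff_char_poly n (f : V -> 'M[C]_n) : differentiable f x -> pdiff (fun y => char_poly (f y)).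
Proof.
move=> hf; apply: pdiff_sum => s; apply: pdiffM; first exact: pdiff_cst.
apply: pdiff_prod => i.
rewrite (_ : (fun y => _) = fun y => 'X *+ (i == s i) + ((- 1)%:P * (f y i (s i))%:P)).
  apply: pdiffD; first exact: pdiff_cst.
  apply: pdiffM; first exact: pdiff_cst.
  apply: pdiff_polyC.
  exact: (differentiable_comp hf (differentiable_coord _ i (s i))).
by apply/funext => y; rewrite !mxE polyCN polyC1 mulN1r.
Qed.

Lemma pdiff_horner (p : V -> {poly C}) (a : C) n : (forall y, (size (p y) <= n)%N) -> pdiff p ->
  differentiable (fun y => (p y).[a] : C) x.
Proof.
move=> sp hp.
rewrite (_ : (fun y => _) = fun y => \sum_(i < n) (p y)`_i * a ^+ i); last first.
  by apply/funext => y; rewrite (horner_coef_wide _ (sp y)).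
apply: differentiable_sumf => i.
exact: differentiableMf (hp i) (differentiable_cst (a ^+ i) x).
Qed.

End MatrixDifferentiability.

(** * Characteristic polynomials, symmetrization and companion matrices *)

Section CharacteristicPolynomial.
Context {R : realType} (n : nat).
Local Notation C := (Cplx R).
Implicit Types (w z : 'rV[C]_n) (A B P : 'M[C]_n) (Omega : set C).

Definition poly_of_sym w : {poly C} :=
  'X^n + \sum_(j < n) ((-1) ^+ j.+1 * w 0 j) *: 'X^(n - j.+1).

Definition sym_of_poly (p : {poly C}) : 'rV[C]_n :=
  \row_j ((-1) ^+ j.+1 * p`_(n - j.+1)).

Let low w : {poly C} := \sum_(j < n) ((-1) ^+ j.+1 * w 0 j) *: 'X^(n - j.+1).

Lemma size_low w : (size (low w) <= n)%N.
Proof.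
apply/leq_sizeP => k nk; rewrite coef_sum big1// => j _.
rewrite coefZ coefXn (_ : (k == _) = false) ?mulr0//.
by apply/negbTE; have := ltn_ord j; lia.
Qed.

Lemma poly_of_sym_monic w : poly_of_sym w \is monic.
Proof. by rewrite monicE lead_coefDl ?lead_coefXn// size_polyXn ltnS size_low. Qed.

Lemma size_poly_of_sym w : size (poly_of_sym w) = n.+1.
Proof. by rewrite size_polyDl size_polyXn// ltnS size_low. Qed.

Lemma poly_of_symK w : sym_of_poly (poly_of_sym w) = w.
Proof.
apply/rowP => j; rewrite mxE coefD coefXn coef_sum.
rewrite (_ : (_ == n) = false); last by apply/negbTE; have := ltn_ord j; lia.
rewrite add0r (bigD1 j)//= big1 ?addr0 => [|i ij].
  by rewrite coefZ coefXn eqxx mulr1 mulrA -expr2 sqrr_sign mul1r.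
rewrite coefZ coefXn (_ : (_ == _) = false) ?mulr0//; apply/negbTE.
move: ij; rewrite -val_eqE /=; have := ltn_ord j; have := ltn_ord i; lia.
Qed.

Lemma sym_of_polyK p : p \is monic -> size p = n.+1 -> poly_of_sym (sym_of_poly p) = p.
Proof.
move=> /monicP; rewrite lead_coefE => mp sp; rewrite sp /= in mp.
rewrite -[RHS]coefK poly_def sp big_ord_recr /= mp scale1r addrC /poly_of_sym; congr (_ + _).
rewrite (reindex_inj rev_ord_inj) /=; apply: eq_bigr => j _.
rewrite mxE mulrA -expr2 sqrr_sign mul1r.
by have -> : (n - (n - j.+1).+1 = j)%N by have := ltn_ord j; lia.
Qed.

Lemma poly_of_sym_symmetrization z :
  poly_of_sym (symmetrization z) = \prod_(j < n) ('X - (z 0 j)%:P).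
Proof. by rewrite symmetrization_prod. Qed.

Definition char_sym A : 'rV[C]_n := sym_of_poly (char_poly A).

Lemma char_symK A : poly_of_sym (char_sym A) = char_poly A.
Proof. by rewrite sym_of_polyK ?char_poly_monic ?size_char_poly. Qed.

Definition companion w : 'M[C]_n := \matrix_(i < n, j < n)
  if i == n.-1 :> nat then - (poly_of_sym w)`_j else (i.+1 == j :> nat)%:R.

Lemma char_poly_companion w : char_poly (companion w) = poly_of_sym w.
Proof.
have h d (p : {poly C}) : p \is monic -> (size p).-1 = d -> char_poly (\matrix_(i < d, j < d)
  (if i == d.-1 :> nat then - p`_j else (i.+1 == j :> nat)%:R)) = p.
  by move=> mp <-; exact: companionmxK.
by apply: h; [exact: poly_of_sym_monic|rewrite size_poly_of_sym].
Qed.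

Lemma char_sym_companion w : char_sym (companion w) = w.
Proof. by rewrite /char_sym char_poly_companion poly_of_symK. Qed.

Lemma spectral_setP Omega A :
  spectral_set n Omega A <-> forall a, root (char_poly A) a -> Omega a.
Proof.
split=> h a; first by rewrite -eigenvalue_root_char; exact: h.
by move=> /= ha; apply: h; rewrite -eigenvalue_root_char.
Qed.

(** The polynomial splits, and its roots are a preimage of w under the
symmetrization. *)
Lemma symmetrized_productP Omega w :
  symmetrized_product n Omega w <-> forall a, root (poly_of_sym w) a -> Omega a.
Proof.
split=> [[z hz <-] a|h].
  rewrite poly_of_sym_symmetrization rootE horner_prod => /prodf_eq0[j _].
  by rewrite hornerXsubC subr_eq0 => /eqP ->; exact: hz.
have [r hr] := closed_field_poly_normal (poly_of_sym w).
have /monicP lp := poly_of_sym_monic w; rewrite lp scale1r in hr.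
have sr : size r = n by have := size_poly_of_sym w; rewrite hr size_prod_XsubC => -[].
have e : poly_of_sym w = \prod_(j < n) ('X - (r`_j)%:P).
  by rewrite hr (big_nth 0) big_mkord sr.
exists (\row_j r`_j) => [j|].
  by rewrite mxE; apply: h; rewrite hr root_prod_XsubC mem_nth// sr.
rewrite -[LHS]poly_of_symK poly_of_sym_symmetrization -[RHS]poly_of_symK e.
by congr sym_of_poly; apply: eq_bigr => j _; rewrite mxE.
Qed.

Lemma spectral_set_companion Omega w :
  spectral_set n Omega (companion w) <-> symmetrized_product n Omega w.
Proof. by rewrite spectral_setP symmetrized_productP char_poly_companion. Qed.

Lemma symmetrized_product_char_sym Omega A :
  symmetrized_product n Omega (char_sym A) <-> spectral_set n Omega A.
Proof. by rewrite spectral_setP symmetrized_productP char_symK. Qed.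

Lemma char_poly_conj P A : P \in unitmx -> char_poly (P *m A *m invmx P) = char_poly A.
Proof.
move=> Pu; rewrite /char_poly.
have -> : char_poly_mx (P *m A *m invmx P) =
    map_mx polyC P *m char_poly_mx A *m map_mx polyC (invmx P).
  rewrite /char_poly_mx mulmxBr mulmxBl -!map_mxM; congr (_ - _).
  by rewrite scalar_mxC -mulmxA -map_mxM mulmxV// map_mx1 mulmx1.
rewrite !det_mulmx mulrAC -det_mulmx -map_mxM mulmxV// map_mx1 det1 mul1r.
by [].
Qed.

End CharacteristicPolynomial.

(** * Fibres of the characteristic polynomial *)

Section SimilarityPaths.
Context {R : realType}.
Local Notation C := (Cplx R).

Definition entire_mx m n (F : C -> 'M[C]_(m, n)) := forall i j, entire (fun z => F z i j).

Lemma entire_mx_cst m n (A : 'M[C]_(m, n)) : entire_mx (fun=> A).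
Proof. by move=> i j; exact: entire_cst. Qed.

Lemma entire_mx_mul m n p (F : C -> 'M[C]_(m, n)) (G : C -> 'M[C]_(n, p)) :
  entire_mx F -> entire_mx G -> entire_mx (fun z => F z *m G z).
Proof.
move=> hF hG i j.
rewrite (_ : (fun z => _) = fun z => \sum_k F z i k * G z k j); last first.
  by apply/funext => z; rewrite mxE.
by apply: entire_sum => k; exact: entireM (hF i k) (hG k j).
Qed.

Lemma entire_mx_inv n (F : C -> 'M[C]_n) : entire_mx F -> (forall z, F z \in unitmx) ->
  entire_mx (fun z => invmx (F z)).
Proof.
move=> hF hu i j.
have d0 z : \det (F z) != 0 by rewrite -unitfE -unitmxE.
rewrite (_ : (fun z => _) = fun z => (\det (F z))^-1 * ((-1) ^+ (j + i) * \det (row' j (col' i (F z))))).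
  apply: entireM; first exact: entireV d0 (entire_det hF).
  apply: entireZ; apply: entire_det => k l.
  rewrite (_ : (fun z => _) = fun z => F z (lift j k) (lift i l)); first exact: hF.
  by apply/funext => z; rewrite !mxE.
by apply/funext => z; rewrite /invmx hu !mxE.
Qed.

Lemma schur_trig n (A : 'M[C]_n) : (0 < n)%N ->
  exists2 P : 'M[C]_n, P \in unitmx & is_trig_mx (P *m A *m invmx P).
Proof.
move=> n0; have [P Pu] := Schur A n0; have Pi := unitarymx_unit Pu.
rewrite /simmx_to_for => h; exists P; first exact: Pi.
by rewrite -conjumx.
Qed.

(** In a triangular form of P the diagonal entries are replaced by exponentials and
the other entries are scaled, so that the determinant never vanishes.  A straight
line from the identity to P would in general meet singular matrices. *)
Lemma entire_path n (P : 'M[C]_n) : (0 < n)%N -> P \in unitmx ->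
  exists X : C -> 'M[C]_n, [/\ entire_mx X, forall z, X z \in unitmx, X 0 = 1%:M & X 1 = P].
Proof.
move=> n0 Pu; have [V Vu] := schur_trig P n0; set T0 := _ *m _ *m _ => Tt.
have PE : P = invmx V *m T0 *m V.
  by rewrite /T0 !mulmxA mulVmx// mul1mx mulmxKV.
have T0d i : T0 i i != 0.
  have : \det T0 != 0.
    by rewrite -unitfE -unitmxE !unitmx_mul Vu Pu unitmx_inv.
  by rewrite det_trig// => /prodf_neq0; apply.
have /choice[t ht] : forall i, exists t, cexp t = T0 i i by move=> i; exact: cexp_surj.
pose T z : 'M[C]_n := \matrix_(i, j) if i == j then cexp (z * t i) else z * T0 i j.
have hT : entire_mx T.
  move=> i j; have [ij|ij] := boolP (i == j).
    rewrite (_ : (fun z => _) = fun z => cexp (z * t i)).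
      by apply: (entire_comp (@entire_cexp R)); apply: entireM; [exact: entire_id|exact: entire_cst].
    by apply/funext => z; rewrite mxE ij.
  rewrite (_ : (fun z => _) = fun z => z * T0 i j).
    by apply: entireM; [exact: entire_id|exact: entire_cst].
  by apply/funext => z; rewrite mxE (negPf ij).
have Tu z : T z \in unitmx.
  rewrite unitmxE unitfE det_trig.
    by apply/prodf_neq0 => i _; rewrite mxE eqxx cexp_neq0.
  apply/is_trig_mxP => i j ij; rewrite mxE -val_eqE (ltn_eqF ij).
  by rewrite (is_trig_mxP Tt)// mulr0.
exists (fun z => invmx V *m T z *m V); split.
- exact: (entire_mx_mul (entire_mx_mul (@entire_mx_cst n n (invmx V)) hT) (@entire_mx_cst n n V)).
- by move=> z; rewrite !unitmx_mul unitmx_inv Vu Tu.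
- have -> : T 0 = 1%:M.
    by apply/matrixP => i j; rewrite !mxE !mul0r cexp0; case: (i == j).
  by rewrite mulmx1 mulVmx.
have -> : T 1 = T0.
  apply/matrixP => i j; rewrite mxE !mul1r.
  by case: eqP => [<-|_]; [exact: ht|].
exact: esym PE.
Qed.

End SimilarityPaths.

Section Fibres.
Context {R : realType} (n : nat).
Local Notation C := (Cplx R).
Variables (Omega : set C) (a : 'I_(2 * n) -> C).
Hypothesis (n0 : (0 < n)%N) (ainj : injective a) (aO : forall k, ~ Omega (a k)).
Local Notation S := (spectral_set n Omega).
Variable Psi : 'M[C]_n -> 'M[C]_n.
Hypothesis hPsi : holomorphic_map S S Psi.

Definition same_image (A B : 'M[C]_n) := char_poly (Psi A) = char_poly (Psi B).

(** The characteristic polynomials of the matrices Psi (g z) have no zero at the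
points a k, which lie outside Omega. *)
Lemma curve_same_image (g : C -> 'M[C]_n) : entire_mx g -> (forall z, S (g z)) ->
  forall z, same_image (g z) (g 0).
Proof.
move=> hg gS; apply: (@monic_family_constant R n (fun z => char_poly (Psi (g z))) a ainj).
- by move=> z; exact: char_poly_monic.
- by move=> z; exact: size_char_poly.
- move=> k z; apply/derivable1_diffP.
  apply: (@pdiff_horner R _ z (fun z => char_poly (Psi (g z))) (a k) n.+1).
    by move=> y; rewrite size_char_poly.
  apply: pdiff_char_poly; apply: (differentiable_comp (f := g)).
    by apply: mx_differentiable => i j; apply/derivable1_diffP; exact: hg.
  exact: hPsi.1 (gS z).
move=> k z; apply/negP => /eqP/rootP hr; apply: (aO (k := k)).
exact: (spectral_setP Omega _).1 (hPsi.2 _ (gS z)) _ hr.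
Qed.

Lemma trig_same_image (T : 'M[C]_n) : is_trig_mx T -> S T ->
  same_image T (diag_mx (\row_i T i i)).
Proof.
move=> Tt TS; pose g z : 'M[C]_n := \matrix_(i, j) if i == j then T i j else z * T i j.
have gE z : char_poly (g z) = char_poly T.
  rewrite !char_poly_trig//; first by apply: eq_bigr => i _; rewrite mxE eqxx.
  apply/is_trig_mxP => i j ij; rewrite mxE -val_eqE (ltn_eqF ij).
  by rewrite (is_trig_mxP Tt)// mulr0.
have gS z : S (g z).
  by apply/spectral_setP => b; rewrite gE; exact: (spectral_setP Omega T).1.
have hg : entire_mx g.
  move=> i j; have [ij|ij] := boolP (i == j).
    rewrite (_ : (fun z => _) = fun=> T i j); first exact: entire_cst.
    by apply/funext => z; rewrite mxE ij.
  rewrite (_ : (fun z => _) = fun z => z * T i j).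
    by apply: entireM; [exact: entire_id|exact: entire_cst].
  by apply/funext => z; rewrite mxE (negPf ij).
have := curve_same_image hg gS 1.
have -> : g 1 = T by apply/matrixP => i j; rewrite mxE mul1r if_same.
have -> // : g 0 = diag_mx (\row_i T i i).
apply/matrixP => i j; rewrite !mxE mul0r; case: (eqVneq i j) => [->|_].
  by rewrite mulr1n.
by rewrite mulr0n.
Qed.

Lemma conj_same_image (P A : 'M[C]_n) : P \in unitmx -> S A ->
  same_image (P *m A *m invmx P) A.
Proof.
move=> Pu AS; have [X [hX Xu X0 X1]] := entire_path n0 Pu.
have := @curve_same_image (fun z => X z *m A *m invmx (X z)) _ _ 1.
rewrite X0 X1 invmx1 mulmx1 mul1mx; apply.
  exact: (entire_mx_mul (entire_mx_mul hX (@entire_mx_cst R n n A)) (entire_mx_inv hX Xu)).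
move=> z; apply/spectral_setP => b; rewrite char_poly_conj//.
exact: (spectral_setP Omega A).1.
Qed.

Lemma diag_perm_same_image (d d' : 'rV[C]_n) : S (diag_mx d) ->
  perm_eq [tuple d 0 i | i < n] [tuple d' 0 i | i < n] ->
  same_image (diag_mx d') (diag_mx d).
Proof.
move=> dS; rewrite perm_sym => /tuple_permP[s hs].
have ds i : d' 0 i = d 0 (s i).
  by have := congr1 (fun t => tnth t i) (val_inj hs); rewrite !tnth_mktuple.
have Pu : (perm_mx s : 'M[C]_n) \in unitmx by exact: unitmx_perm.
have -> : diag_mx d' = perm_mx s *m diag_mx d *m invmx (perm_mx s).
  apply: (canRL (mulmxK Pu)); apply/matrixP => i j.
  rewrite mul_diag_mx mul_mx_diag !mxE ds.
  by case: (eqVneq (s i) j) => [->|_]; rewrite ?mulr1 ?mul1r ?mulr0 ?mul0r.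
exact: conj_same_image.
Qed.

Lemma char_poly_diag (d : 'rV[C]_n) : char_poly (diag_mx d) = \prod_i ('X - (d 0 i)%:P).
Proof.
rewrite char_poly_trig ?diag_mx_is_trig//.
by apply: eq_bigr => i _; rewrite mxE eqxx mulr1n.
Qed.

(** Both matrices are joined to diagonal matrices, which differ by a permutation of
the diagonal. *)
Theorem fibre_same_image (A B : 'M[C]_n) : S A -> S B -> char_poly A = char_poly B ->
  same_image A B.
Proof.
have to_diag D : S D -> exists d, [/\ S (diag_mx d), same_image D (diag_mx d) &
    char_poly D = char_poly (diag_mx d)].
  move=> DS; have [P Pu] := schur_trig D n0; set T := _ *m _ *m _ => Tt.
  have TD : char_poly T = char_poly D by exact: char_poly_conj.
  have TS : S T by apply/spectral_setP => b; rewrite TD; exact: (spectral_setP Omega D).1.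
  have Td : char_poly (diag_mx (\row_i T i i)) = char_poly T.
    rewrite char_poly_diag (char_poly_trig Tt); apply: eq_bigr => i _; by rewrite mxE.
  exists (\row_i T i i); split.
  - by apply/spectral_setP => b; rewrite Td; exact: (spectral_setP Omega T).1.
  - by rewrite /same_image -(conj_same_image Pu DS); exact: trig_same_image.
  - exact: esym (etrans Td TD).
move=> AS BS; have [d [dS Ad Ad']] := to_diag A AS; have [e [eS Be Be']] := to_diag B BS.
rewrite Ad' Be' !char_poly_diag => h.
have tE (f : 'rV[C]_n) : \prod_(c <- [tuple f 0 i | i < n]) ('X - c%:P) = \prod_i ('X - (f 0 i)%:P).
  by rewrite big_tuple; apply: eq_bigr => i _; rewrite tnth_mktuple.
have swap : same_image (diag_mx d) (diag_mx e).
  apply: (diag_perm_same_image eS); apply: prod_XsubC_eq; rewrite !tE; exact: esym h.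
by move: Ad swap Be; rewrite /same_image => -> -> ->.
Qed.

(** The map of the symmetrized product covered by Psi; the companion matrix is a
holomorphic section of the characteristic polynomial. *)
Definition pushdown (w : 'rV[C]_n) : 'rV[C]_n := char_sym (Psi (companion w)).

Lemma pushdown_char_sym A : S A -> pushdown (char_sym A) = char_sym (Psi A).
Proof.
move=> AS; apply: (congr1 (@sym_of_poly R n)).
have cS : S (companion (char_sym A)).
  by apply/spectral_set_companion/symmetrized_product_char_sym.
apply: (fibre_same_image cS AS).
by rewrite char_poly_companion; exact: char_symK.
Qed.

Lemma pushdown_holomorphic :
  holomorphic_map (symmetrized_product n Omega) (symmetrized_product n Omega) pushdown.
Proof.
split=> w /spectral_set_companion wS; last first.
  by apply/symmetrized_product_char_sym; exact: hPsi.2.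
apply: mx_differentiable => i j.
have dc : differentiable (@companion R n) w.
  apply: mx_differentiable => k l; have [kn|kn] := boolP (k == n.-1 :> nat).
    rewrite (_ : (fun y => _) = fun y => ((-1)%:P * poly_of_sym y)`_l); last first.
      by apply/funext => y; rewrite mxE kn coefCM mulN1r.
    apply: (pdiffM (pdiff_cst _ _)).
    apply: (pdiffD (pdiff_cst _ _)); apply: pdiff_sum => m.
    have -> : (fun y : 'rV[C]_n => ((-1) ^+ m.+1 * y 0 m) *: ('X^(n - m.+1) : {poly C})) =
        fun y => ((-1) ^+ m.+1)%:P * (y 0 m)%:P * 'X^(n - m.+1).
      by apply/funext => y; rewrite -mul_polyC polyCM.
    apply: pdiffM (pdiff_cst _ _); apply: (pdiffM (pdiff_cst _ _)).
    by apply: pdiff_polyC; exact: differentiable_coord.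
  rewrite (_ : (fun y => _) = cst (k.+1 == l :> nat)%:R); first exact: differentiable_cst.
  by apply/funext => y; rewrite mxE (negPf kn).
rewrite (_ : (fun y => _) = fun y => ((((-1) ^+ j.+1)%:P : {poly C}) * char_poly (Psi (companion y)))`_(n - j.+1)); last first.
  by apply/funext => y; rewrite ord1 mxE coefCM.
apply: (pdiffM (pdiff_cst _ _)); apply: pdiff_char_poly.
exact: differentiable_comp dc (hPsi.1 _ wS).
Qed.

End Fibres.

(** * Descent to the symmetrized product *)

Lemma symmetrization_const (R : realType) n (x y : Cplx R) : (0 < n)%N ->
  symmetrization (const_mx x : 'rV_n) = symmetrization (const_mx y : 'rV_n) -> x = y.
Proof.
move=> n0 /(congr1 (@poly_of_sym R n)); rewrite !poly_of_sym_symmetrization => h.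
have : root (\prod_(j < n) ('X - ((const_mx x : 'rV[Cplx R]_n) 0 j)%:P)) x.
  by rewrite rootE horner_prod (bigD1 (Ordinal n0))//= mxE hornerXsubC subrr mul0r.
rewrite h rootE horner_prod => /prodf_eq0[j _].
by rewrite mxE hornerXsubC subr_eq0 => /eqP.
Qed.

Lemma open_other_point (R : realType) (Omega : set (Cplx R)) x : open Omega -> Omega x ->
  exists2 y, Omega y & y != x.
Proof.
move=> oO Ox; have : nbhs x Omega by exact: open_nbhs_nbhs.
move=> /nbhs_ballP[e /= e0 he]; exists (x + e / 2).
  apply: he; rewrite /ball /= opprD addrA subrr sub0r normrN.
  by rewrite ger0_norm ?divr_ge0 ?(ltW e0)// ltr_pdivrMr// mulr_natr mulr2n ltrDl.
by rewrite -subr_eq0 addrC addKr mulf_neq0 ?invr_eq0 ?pnatr_eq0// gt_eqF.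
Qed.

Lemma spectrum_roots (R : realType) n (A : 'M[Cplx R]_n) (z : 'rV[Cplx R]_n) :
  char_poly A = \prod_j ('X - (z 0 j)%:P) -> spectrum A = [set x | exists j, x = z 0 j].
Proof.
move=> h; apply/seteqP; split=> x; rewrite /spectrum /=.
  rewrite eigenvalue_root_char h rootE horner_prod => /prodf_eq0[j _].
  by rewrite hornerXsubC subr_eq0 => /eqP ->; exists j.
move=> [j ->]; rewrite eigenvalue_root_char h rootE horner_prod.
by apply/prodf_eq0; exists j => //; rewrite hornerXsubC subrr.
Qed.

Section Descent.
Context {R : realType} (n : nat).
Local Notation C := (Cplx R).
Variables (Omega : set C) (a : 'I_(2 * n) -> C).
Hypothesis (n0 : (0 < n)%N) (ainj : injective a) (aO : forall k, ~ Omega (a k)).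

Lemma pushdown_inverse (Psi G : 'M[C]_n -> 'M[C]_n) :
  holomorphic_map (spectral_set n Omega) (spectral_set n Omega) Psi ->
  holomorphic_map (spectral_set n Omega) (spectral_set n Omega) G ->
  (forall A, spectral_set n Omega A -> G (Psi A) = A) ->
  forall w, symmetrized_product n Omega w -> pushdown G (pushdown Psi w) = w.
Proof.
move=> hP hG GP w /spectral_set_companion wS.
rewrite {2}/pushdown (pushdown_char_sym n0 ainj aO hG (hP.2 _ wS)) GP//.
exact: char_sym_companion.
Qed.

Lemma pushdown_automorphism (Psi : 'M[C]_n -> 'M[C]_n) :
  is_automorphism (spectral_set n Omega) Psi ->
  is_automorphism (symmetrized_product n Omega) (pushdown Psi).
Proof.
move=> [hP [G [hG GP PG]]]; split; first exact: pushdown_holomorphic.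
exists (pushdown G); split; first exact: pushdown_holomorphic.
  exact: pushdown_inverse.
exact: pushdown_inverse.
Qed.

Lemma pushdown_const (Psi : 'M[C]_n -> 'M[C]_n) (phi : C -> C) :
  (forall w, symmetrized_product n Omega w -> pushdown Psi w = symmetrized_map Omega phi w) ->
  forall x, Omega x ->
    pushdown Psi (symmetrization (const_mx x)) = symmetrization (const_mx (phi x)).
Proof.
move=> h x Ox; have cx : cartesian_power Omega (const_mx x : 'rV[C]_n) by move=> j; rewrite mxE.
rewrite h; last by exists (const_mx x).
by rewrite symmetrized_mapE// map_const_mx.
Qed.

(** Evaluation on the diagonal of Omega^n, where a symmetrized point determines its
only coordinate. *)
Lemma covering_inverse (Psi G : 'M[C]_n -> 'M[C]_n) (phi phi' : C -> C) :
  holomorphic_map (spectral_set n Omega) (spectral_set n Omega) Psi ->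
  holomorphic_map (spectral_set n Omega) (spectral_set n Omega) G ->
  (forall A, spectral_set n Omega A -> G (Psi A) = A) ->
  set_fun Omega Omega phi ->
  (forall w, symmetrized_product n Omega w -> pushdown Psi w = symmetrized_map Omega phi w) ->
  (forall w, symmetrized_product n Omega w -> pushdown G w = symmetrized_map Omega phi' w) ->
  forall x, Omega x -> phi' (phi x) = x.
Proof.
move=> hP hG GP phiO hphi hphi' x Ox; apply: (symmetrization_const n0).
rewrite -(pushdown_const hphi' (phiO _ Ox)) -(pushdown_const hphi Ox).
by apply: (pushdown_inverse hP hG GP); exists (const_mx x) => // j; rewrite mxE.
Qed.

Lemma spectrum_covering (Psi : 'M[C]_n -> 'M[C]_n) (phi : C -> C) :
  holomorphic_map (spectral_set n Omega) (spectral_set n Omega) Psi ->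
  (forall w, symmetrized_product n Omega w -> pushdown Psi w = symmetrized_map Omega phi w) ->
  forall A, spectral_set n Omega A -> spectrum (Psi A) = phi @` spectrum A.
Proof.
move=> hP hphi A AS.
have /symmetrized_product_char_sym[z zO zA] := AS.
have hA : char_poly A = \prod_j ('X - (z 0 j)%:P).
  by rewrite -char_symK -zA poly_of_sym_symmetrization.
have hPA : char_poly (Psi A) = \prod_j ('X - ((map_mx phi z) 0 j)%:P).
  rewrite -char_symK -(pushdown_char_sym n0 ainj aO hP AS) -zA hphi; last by exists z.
  by rewrite symmetrized_mapE// poly_of_sym_symmetrization.
rewrite (spectrum_roots hA) (spectrum_roots hPA); apply/seteqP; split=> x /=.
  by move=> [j ->]; exists (z 0 j); [exists j|rewrite mxE].
by move=> [_ [j ->] <-]; exists j; rewrite mxE.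
Qed.

End Descent.

Theorem theorem1p1 (R : realType) (Omega : set (Cplx R)) (n : nat)
  (hOmega : is_domain Omega)
  (hn : (2 <= n)%N)
  (hcard : ([set: 'I_(2 * n)] #<= ~` Omega)%card)
  (hAut : forall Phi : 'rV[Cplx R]_n -> 'rV[Cplx R]_n,
     is_automorphism (symmetrized_product n Omega) Phi ->
     exists phi : Cplx R -> Cplx R,
       holomorphic_map Omega Omega phi /\
       forall w, symmetrized_product n Omega w ->
         Phi w = symmetrized_map Omega phi w) :
  (forall Psi : 'M[Cplx R]_n -> 'M[Cplx R]_n,
     is_automorphism (spectral_set n Omega) Psi ->
     exists psi : Cplx R -> Cplx R,
       is_automorphism Omega psi /\
       forall A, spectral_set n Omega A ->
         spectrum (Psi A) = psi @` spectrum A) /\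
  ~ acts_transitively (spectral_set n Omega).
Proof.
have n0 : (0 < n)%N by exact: leq_trans hn.
have [a ainj aO] : exists2 a : 'I_(2 * n) -> Cplx R, injective a & forall k, ~ Omega (a k).
  have /pcard_leP[f] := hcard; exists f => [i j|k]; first by apply: inj; rewrite in_setT.
  exact: (@funS _ _ _ _ f k I).
have main : forall Psi : 'M[Cplx R]_n -> 'M[Cplx R]_n,
     is_automorphism (spectral_set n Omega) Psi ->
     exists psi : Cplx R -> Cplx R,
       is_automorphism Omega psi /\
       forall A, spectral_set n Omega A ->
         spectrum (Psi A) = psi @` spectrum A.
  move=> Psi PsiA; have [hP [G [hG GP PG]]] := PsiA.
  have GA : is_automorphism (spectral_set n Omega) G by split=> //; exists Psi; split.
  have [phi [phiH hphi]] := hAut _ (pushdown_automorphism n0 ainj aO PsiA).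
  have [phi' [phiH' hphi']] := hAut _ (pushdown_automorphism n0 ainj aO GA).
  exists phi; split; last exact: (spectrum_covering n0 ainj aO hP hphi).
  split; first exact: phiH.
  exists phi'; split; first exact: phiH'.
    exact: (covering_inverse n0 ainj aO hP hG GP phiH.2 hphi hphi').
  exact: (covering_inverse n0 ainj aO hG hP PG phiH'.2 hphi' hphi).
split; first exact: main.
move=> trans; have [[x Ox] oO _] := hOmega.
have [y Oy yx] := open_other_point oO Ox.
pose d : 'rV[Cplx R]_n := \row_j if j == Ordinal n0 then x else y.
pose c : 'rV[Cplx R]_n := const_mx x.
have sp (e : 'rV[Cplx R]_n) := spectrum_roots (char_poly_diag e).
have dS : spectral_set n Omega (diag_mx d).
  by rewrite /spectral_set /= sp => _ [j ->]; rewrite mxE; case: ifP.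
have cS : spectral_set n Omega (diag_mx c).
  by rewrite /spectral_set /= sp => _ [j ->]; rewrite mxE.
have [Psi [PsiA Pcd]] := trans _ _ cS dS.
have [psi [_ /(_ _ cS)]] := main _ PsiA; rewrite Pcd !sp => h.
have val t : (exists j, t = d 0 j) -> t = psi x.
  move=> ht; have : [set t | exists j, t = d 0 j] t by [].
  by rewrite h => -[_ [j ->] <-]; rewrite mxE.
have hx : x = psi x by apply: val; exists (Ordinal n0); rewrite mxE eqxx.
have hy : y = psi x by apply: val; exists (Ordinal hn); rewrite mxE -val_eqE.
by move: yx; rewrite hy -hx eqxx.
Qed.
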